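(* Let $\mathcal C$, $\mathcal J$, $\mathcal R$, $\mathcal L_+$ and $\nabla$ be as defined in the context and let $H_0=-\sum_{k=-\infty}^\infty\log(1-q_kr_k)$. The evolution equations $$((q_k,r_k)^T)_t=\mathcal R^n\mathcal J\nabla_kH_0,\qquad n\ge0,$$ are equivalent to a sub-hierarchy of the Chiu--Ladik family $$((-r_k,q_k)^T)_t=\mathcal P(\mathcal L_+)(r_k,q_k)^T,\qquad \mathcal P\ \text{an arbitrary polynomial},$$ i.e. each of them is equivalent to an equation of this form, and they are thus integrable (as members of this family of integrable equations).
   Context: Phase space. $\mathcal C$ is the space of sequences $(q_k,r_k)^T_{k\in\mathbb Z}$ in $\mathbb C^2$ with $|q_k|,|r_k|\to0$ as $k\to\pm\infty$; potentials are assumed to vanish rapidly (so that all sums below converge) and $1-r_kq_k\ne0$. On the tangent space at $(q,r)^T$ one has the (non-Hermitian) bilinear form $$\langle(a,b)^T,(c,d)^T\rangle=-\sum_{k\in\mathbb Z}(a_kd_k+b_kc_k)(1-q_kr_k)^{-1},$$ and $^*$ denotes the adjoint with respect to it. The functional gradient of a functional $F$ on $\mathcal C$ is $\nabla_kF=-(1-q_kr_k)\,(\delta F/\delta r_k,\ \delta F/\delta q_k)^T$. Let $\mathcal J$ act as $\mathrm{diag}(-i,i)$ at each site and let $\sigma_3=\mathrm{diag}(1,-1)$. In particular $\mathcal J\nabla_kH_0=i(q_k,-r_k)^T$. Operators. For $w=(u_k,v_k)^T_{k\in\mathbb Z}$ put $s_j=\dfrac{q_ju_j-r_jv_j}{1-r_jq_j}$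 and $$(Lw)_k=\begin{pmatrix} u_{k-1}-(1-r_kq_k)r_{k-1}\sum_{j\ge k}s_j-r_k\sum_{j\ge k}(q_ju_{j-1}-r_jv_{j+1})\\ v_{k+1}-(1-r_kq_k)q_{k+1}\sum_{j\ge k+1}s_j-q_k\sum_{j\ge k+1}(q_ju_{j-1}-r_jv_{j+1})\end{pmatrix},$$ $$(L^{-1}w)_k=\begin{pmatrix} u_{k+1}+(1-r_kq_k)r_{k+1}\sum_{j\ge k+1}s_j+r_k\sum_{j\ge k+1}(q_ju_{j+1}-r_jv_{j-1})\\ v_{k-1}+(1-r_kq_k)q_{k-1}\sum_{j\ge k}s_j+q_k\sum_{j\ge k}(q_ju_{j+1}-r_jv_{j-1})\end{pmatrix}.$$ Set $\mathcal L_+=L+L^{-1}$ and $\mathcal L_-=\sigma_3\mathcal L_+^*\sigma_3^{-1}$; explicitly, with $t_j=q_j(u_{j+1}-u_{j-1})+r_j(v_{j+1}-v_{j-1})$, $$(\mathcal L_-w)_k=\begin{pmatrix} u_{k+1}+u_{k-1}-(1-r_kq_k)\left[r_{k+1}\sum_{j\le k}s_j-r_{k-1}\sum_{j\le k-1}s_j\right]-r_k\sum_{j\le k}t_j-r_kq_ku_{k-1}+r_k^2v_{k+1}\\ v_{k+1}+v_{k-1}+(1-r_kq_k)\left[q_{k+1}\sum_{j\le k}s_j-q_{k-1}\sum_{j\le k-1}s_j\right]-q_k\sum_{j\le k}t_j+q_k^2u_{k+1}-q_kr_kv_{k-1}\end{pmatrix}.$$ Finally $$\mathcal R=\begin{pmatrix}0&1\\-1&0\end{pmatrix}(\mathcal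 L_++\mathcal L_-)\begin{pmatrix}0&-1\\1&0\end{pmatrix}.$$ Here ''integrable'' has the paper's meaning: belonging to the family of inverse-scattering integrable equations $((-r_k,q_k)^T)_t=\omega(L)(r_k,q_k)^T$ with $\omega(x)=\omega_1(x)+\omega_2(x^{-1})$, which contains the family $((-r_k,q_k)^T)_t=\mathcal P(\mathcal L_+)(r_k,q_k)^T$. Polynomials have complex coefficients. *)

(* Defs.v *)
From Stdlib Require Import Reals ZArith List Lra Lia.
From Coquelicot Require Import Coquelicot.

Set Implicit Arguments.

Open Scope C_scope.

(** * Sums over [Z]

    Convergent complex series are summed through their real and imaginary
    parts; all the sequences summed below are absolutely summable. *)

Definition CSeries (a : nat -> C) : C :=
  (Series (fun n => Re (a n)), Series (fun n => Im (a n))).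

Definition sum_ge (a : Z -> C) (k : Z) : C :=
  CSeries (fun n => a (k + Z.of_nat n)%Z).

Definition sum_le (a : Z -> C) (k : Z) : C :=
  CSeries (fun n => a (k - Z.of_nat n)%Z).

Definition sumZ (a : Z -> C) : C := sum_ge a 0%Z + sum_le a (-1)%Z.

Definition summable (a : Z -> C) : Prop :=
  ex_series (fun n => Cmod (a (Z.of_nat n))) /\
  ex_series (fun n => Cmod (a (- Z.of_nat n)%Z)).

(** * Phase space

    A [field] is a sequence of pairs: a potential [(q_k, r_k)] or a tangent
    vector [(u_k, v_k)]. *)

Definition field := Z -> C * C.

Definition decaying (w : field) : Prop :=
  summable (fun k => fst (w k)) /\ summable (fun k => snd (w k)).

Definition dens (p : field) (k : Z) : C := 1 - snd (p k) * fst (p k).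

(* Rapid decay is read as absolute summability: it contains every faster rate
   of decay, forces |q_k|, |r_k| -> 0, and is stable under the operators
   below, whose defining sums then all converge absolutely. *)
Definition phase_space (p : field) : Prop :=
  decaying p /\ forall k, dens p k <> 0.

Definition fadd (w w' : field) : field :=
  fun k => (fst (w k) + fst (w' k), snd (w k) + snd (w' k)).

Definition fscal (c : C) (w : field) : field :=
  fun k => (c * fst (w k), c * snd (w k)).

Definition form (p w w' : field) : C :=
  - sumZ (fun k => (fst (w k) * snd (w' k) + snd (w k) * fst (w' k)) / dens p k).

Definition sigma3 (w : field) : field := fun k => (fst (w k), - snd (w k)).

Definition J (w : field) : field := fun k => (- Ci * fst (w k), Ci * snd (w k)).

(** * Functional gradient and the functional H_0 *)

Definition upd_q (p : field) (k : Z) (x : C) : field :=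
  fun j => if Z.eq_dec j k then (x, snd (p j)) else p j.

Definition upd_r (p : field) (k : Z) (x : C) : field :=
  fun j => if Z.eq_dec j k then (fst (p j), x) else p j.

Definition delta_q (F : field -> C) (p : field) (k : Z) : C :=
  C_derive (fun x => F (upd_q p k x)) (fst (p k)).

Definition delta_r (F : field -> C) (p : field) (k : Z) : C :=
  C_derive (fun x => F (upd_r p k x)) (snd (p k)).

Definition nabla (F : field -> C) (p : field) : field :=
  fun k => (- dens p k * delta_r F p k, - dens p k * delta_q F p k).

(* Principal argument, in (-PI, PI]; the second branch is the negative real
   axis (and 0). *)
Definition Carg (z : C) : R :=
  if Rlt_dec 0 (Cmod z + Re z)
  then (2 * atan (Im z / (Cmod z + Re z)))%R else PI.

Definition Clog (z : C) : C := (ln (Cmod z), Carg z).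

(* The determination of the logarithm which is holomorphic around [z0 <> 0]
   and takes the principal value at [z0]. *)
Definition Clog_near (z0 z : C) : C := Clog z0 + Clog (z / z0).

(* H_0 is multivalued, since [1 - q_k r_k] may wind around 0.  [H0 p0] is its
   determination around the potential [p0]; [H0 p0 p0] is the sum of the
   principal values.  Gradients do not depend on the determination. *)
Definition H0 (p0 p : field) : C :=
  - sumZ (fun k => Clog_near (dens p0 k) (dens p k)).

(** * Operators *)

Definition s_ (p w : field) (j : Z) : C :=
  (fst (p j) * fst (w j) - snd (p j) * snd (w j)) / dens p j.

Definition t_ (p w : field) (j : Z) : C :=
  fst (p j) * (fst (w (j + 1)%Z) - fst (w (j - 1)%Z))
  + snd (p j) * (snd (w (j + 1)%Z) - snd (w (j - 1)%Z)).

Definition L (p w : field) : field := fun k =>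
  let q j := fst (p j) in let r j := snd (p j) in
  let u j := fst (w j) in let v j := snd (w j) in
  let m j := q j * u (j - 1)%Z - r j * v (j + 1)%Z in
  ( u (k - 1)%Z - dens p k * r (k - 1)%Z * sum_ge (s_ p w) k
      - r k * sum_ge m k,
    v (k + 1)%Z - dens p k * q (k + 1)%Z * sum_ge (s_ p w) (k + 1)
      - q k * sum_ge m (k + 1) ).

Definition Linv (p w : field) : field := fun k =>
  let q j := fst (p j) in let r j := snd (p j) in
  let u j := fst (w j) in let v j := snd (w j) in
  let m j := q j * u (j + 1)%Z - r j * v (j - 1)%Z in
  ( u (k + 1)%Z + dens p k * r (k + 1)%Z * sum_ge (s_ p w) (k + 1)
      + r k * sum_ge m (k + 1),
    v (k - 1)%Z + dens p k * q (k - 1)%Z * sum_ge (s_ p w) k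
      + q k * sum_ge m k ).

Definition Lplus (p w : field) : field := fadd (L p w) (Linv p w).

(* The closed form of [sigma3 o Lplus^* o sigma3^-1], where ^* is the adjoint
   for [form p]: see [Lminus_adjoint] below. *)
Definition Lminus (p w : field) : field := fun k =>
  let q j := fst (p j) in let r j := snd (p j) in
  let u j := fst (w j) in let v j := snd (w j) in
  ( u (k + 1)%Z + u (k - 1)%Z
      - dens p k * (r (k + 1)%Z * sum_le (s_ p w) k
                    - r (k - 1)%Z * sum_le (s_ p w) (k - 1))
      - r k * sum_le (t_ p w) k
      - r k * q k * u (k - 1)%Z + r k ^ 2 * v (k + 1)%Z,
    v (k + 1)%Z + v (k - 1)%Z
      + dens p k * (q (k + 1)%Z * sum_le (s_ p w) k
                    - q (k - 1)%Z * sum_le (s_ p w) (k - 1))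
      - q k * sum_le (t_ p w) k
      + q k ^ 2 * u (k + 1)%Z - q k * r k * v (k - 1)%Z ).

(* Multiplication by the matrix (0 1; -1 0) and by its inverse. *)
Definition rot (w : field) : field := fun k => (snd (w k), - fst (w k)).
Definition rot_inv (w : field) : field := fun k => (- snd (w k), fst (w k)).

Definition Rop (p w : field) : field :=
  rot (fadd (Lplus p (rot_inv w)) (Lminus p (rot_inv w))).

(* [P] lists the coefficients of a polynomial, constant term first:
   [op_poly P A w] is the sum of the [P_j A^j w]. *)
Fixpoint op_poly (P : list C) (A : field -> field) (w : field) : field :=
  match P with
  | nil => fun _ => (RtoC 0, RtoC 0)
  | c :: P' => fadd (fscal c w) (op_poly P' A (A w))
  end.

(** * Evolution equations

    An equation is a condition on a curve of potentials at an instant; a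
    solution on a time interval satisfies it at every instant there. *)

Definition has_velocity (w : R -> field) (t : R) (v : field) : Prop :=
  forall k : Z,
    @is_derive R_AbsRing C_R_NormedModule (fun s => fst (w s k)) t (fst (v k)) /\
    @is_derive R_AbsRing C_R_NormedModule (fun s => snd (w s k)) t (snd (v k)).

Definition equation := (R -> field) -> R -> Prop.

Definition equivalent (E E' : equation) : Prop :=
  forall (p : R -> field) (t : R), phase_space (p t) -> (E p t <-> E' p t).

Definition swap (p : field) : field := fun k => (snd (p k), fst (p k)).

Definition R_flow (n : nat) : equation := fun p t =>
  has_velocity p t
    (Nat.iter n (Rop (p t)) (J (nabla (H0 (p t)) (p t)))).

(* [rot_inv] maps the potential (q_k, r_k) to (- r_k, q_k). *)
Definition Chiu_Ladik (P : list C) : equation := fun p t =>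
  has_velocity (fun s => rot_inv (p s)) t
    (op_poly P (Lplus (p t)) (swap (p t))).

(* The dispersion relation is omega(x) = omega_1(x) + omega_2(1/x). *)
Definition omega_flow (w1 w2 : list C) : equation := fun p t =>
  has_velocity (fun s => rot_inv (p s)) t
    (fadd (op_poly w1 (L (p t)) (swap (p t)))
          (op_poly w2 (Linv (p t)) (swap (p t)))).

Definition integrable (E : equation) : Prop :=
  exists w1 w2 : list C, equivalent E (omega_flow w1 w2).

(** * [Lminus] and the adjoint of [Lplus] *)

Lemma Re_le_Cmod z : (Rabs (Re z) <= Cmod z)%R.
Proof. apply Rle_trans with (2 := Rmax_Cmod z); apply Rmax_l. Qed.
Lemma Im_le_Cmod z : (Rabs (Im z) <= Cmod z)%R.
Proof. apply Rle_trans with (2 := Rmax_Cmod z); apply Rmax_r. Qed.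

Lemma Cmod_parts z : (Cmod z <= Rabs (Re z) + Rabs (Im z))%R.
Proof.
  replace z with ((Re z : C) + Ci * (Im z : C)) at 1.
  - eapply Rle_trans; [apply Cmod_triangle|].
    rewrite Cmod_mult, !Cmod_R.
    replace (Cmod Ci) with 1%R; [lra|].
    unfold Cmod, Ci; simpl. rewrite <- sqrt_1 at 1. f_equal. ring.
  - destruct z as [x y]; unfold Cplus, Cmult, Ci, RtoC; simpl; f_equal; ring.
Qed.

Lemma ex_parts (a : nat -> C) : ex_series (fun n => Cmod (a n)) ->
  ex_series (fun n => Re (a n)) /\ ex_series (fun n => Im (a n)).
Proof.
  intros H; split; apply (@ex_series_le R_AbsRing R_CompleteNormedModule _ (fun n => Cmod (a n)));
  try exact H; intros n; [apply Re_le_Cmod | apply Im_le_Cmod].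
Qed.

Lemma CSeries_plus a b :
  ex_series (fun n => Cmod (a n)) -> ex_series (fun n => Cmod (b n)) ->
  CSeries (fun n => a n + b n) = CSeries a + CSeries b.
Proof.
  intros Ha Hb. destruct (ex_parts _ Ha), (ex_parts _ Hb).
  unfold CSeries, Cplus; simpl; f_equal; rewrite <- Series_plus; trivial.
Qed.

Lemma CSeries_opp a : CSeries (fun n => - a n) = - CSeries a.
Proof. unfold CSeries, Copp; simpl; f_equal; rewrite <- Series_opp; trivial. Qed.

Lemma CSeries_ext a b : (forall n, a n = b n) -> CSeries a = CSeries b.
Proof. intros H; unfold CSeries; f_equal; apply Series_ext; intros n; now rewrite H. Qed.

Lemma CSeries_incr a : ex_series (fun n => Cmod (a n)) ->
  CSeries a = a 0%nat + CSeries (fun n => a (S n)).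
Proof.
  intros H. destruct (ex_parts _ H). unfold CSeries, Cplus; simpl.
  rewrite (Series_incr_1 (fun n => Re (a n))), (Series_incr_1 (fun n => Im (a n)));
    trivial.
Qed.

Definition seq_bounded (a : Z -> C) := exists M : R, forall k, (Cmod (a k) <= M)%R.

Lemma summable_ext a b : (forall k, a k = b k) -> summable a -> summable b.
Proof.
  intros H [H1 H2]; split; [revert H1 | revert H2];
  apply ex_series_ext; intros n; now rewrite H.
Qed.

Lemma summable_le a b (M : R) : (forall k, Cmod (b k) <= M * Cmod (a k))%R ->
  summable a -> summable b.
Proof.
  assert (K : forall f g : nat -> C, (forall n, Cmod (g n) <= M * Cmod (f n))%R ->
    ex_series (fun n => Cmod (f n)) -> ex_series (fun n => Cmod (g n))).
  { intros f g Hfg Hf.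
    apply (@ex_series_le R_AbsRing R_CompleteNormedModule _
             (fun n => M * Cmod (f n))%R).
    - intros n; unfold norm; simpl. unfold abs; simpl.
      rewrite Rabs_pos_eq by apply Cmod_ge_0. apply Hfg.
    - now apply (@ex_series_scal R_AbsRing R_NormedModule M). }
  intros H [H1 H2]; split; [apply (K _ _ (fun n => H _) H1)
                           | apply (K _ _ (fun n => H _) H2)].
Qed.

Lemma summable_plus a b : summable a -> summable b -> summable (fun k => a k + b k).
Proof.
  assert (K : forall f g : nat -> C, ex_series (fun n => Cmod (f n)) ->
    ex_series (fun n => Cmod (g n)) -> ex_series (fun n => Cmod (f n + g n))).
  { intros f g Hf Hg.
    apply (@ex_series_le R_AbsRing R_CompleteNormedModule _
             (fun n => Cmod (f n) + Cmod (g n))%R).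
    - intros n; unfold norm; simpl. unfold abs; simpl.
      rewrite Rabs_pos_eq by apply Cmod_ge_0. apply Cmod_triangle.
    - now apply (@ex_series_plus R_AbsRing R_NormedModule). }
  intros [H1 H2] [H3 H4]; split; now apply K.
Qed.

Lemma summable_opp a : summable a -> summable (fun k => - a k).
Proof. apply summable_le with 1%R; intros k; rewrite Cmod_opp; lra. Qed.

Lemma summable_minus a b : summable a -> summable b -> summable (fun k => a k - b k).
Proof. intros; now apply summable_plus, summable_opp. Qed.

Lemma summable_mulr a b : summable a -> seq_bounded b -> summable (fun k => a k * b k).
Proof.
  intros Ha [M HM]; apply (@summable_le a _ M) with (2 := Ha); intros k.
  rewrite Cmod_mult, Rmult_comm. apply Rmult_le_compat_r; auto using Cmod_ge_0.
Qed.

Lemma summable_mull a b : seq_bounded a -> summable b -> summable (fun k => a k * b k).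
Proof.
  intros Ha Hb; apply summable_ext with (fun k => b k * a k);
  [intros; ring | now apply summable_mulr].
Qed.

Lemma summable_S a : summable a -> summable (fun k => a (k + 1)%Z).
Proof.
  intros [H1 H2]; split.
  - apply ex_series_incr_1 in H1; revert H1; apply ex_series_ext; intros n.
    do 2 f_equal; lia.
  - apply ex_series_incr_1. revert H2; apply ex_series_ext; intros n.
    do 2 f_equal; lia.
Qed.

Lemma summable_P a : summable a -> summable (fun k => a (k - 1)%Z).
Proof.
  intros [H1 H2]; split.
  - apply ex_series_incr_1. revert H1; apply ex_series_ext; intros n.
    do 2 f_equal; lia.
  - apply ex_series_incr_1 in H2; revert H2; apply ex_series_ext; intros n.
    do 2 f_equal; lia.
Qed.

Lemma summable_ge a (k : Z) : summable a ->
  ex_series (fun n => Cmod (a (k + Z.of_nat n)%Z)).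
Proof.
  intros H. enough (K : forall a, summable a ->
    summable (fun j => a (k + j)%Z)) by (apply (K a H)).
  clear a H. 
  assert (K1 : forall (m : nat) a, summable a -> summable (fun j => a (Z.of_nat m + j)%Z)).
  { induction m; intros a H; [revert H; apply summable_ext; intros; f_equal; lia|].
    apply summable_S, IHm in H. revert H; apply summable_ext; intros; f_equal; lia. }
  assert (K2 : forall (m : nat) a, summable a -> summable (fun j => a (- Z.of_nat m + j)%Z)).
  { induction m; intros a H; [revert H; apply summable_ext; intros; f_equal; lia|].
    apply summable_P, IHm in H. revert H; apply summable_ext; intros; f_equal; lia. }
  intros a H. destruct (Z_le_gt_dec 0 k).
  - rewrite <- (Z2Nat.id k) by lia; now apply K1.
  - replace k with (- Z.of_nat (Z.to_nat (- k)))%Z by lia; now apply K2.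
Qed.

Definition zflip (a : Z -> C) : Z -> C := fun k => a (- k)%Z.

Lemma summable_flip a : summable a -> summable (zflip a).
Proof.
  intros [H1 H2]; split; [exact H2|]; revert H1; apply ex_series_ext; intros n.
  unfold zflip; do 2 f_equal; lia.
Qed.

Lemma sum_le_flip a k : sum_le a k = sum_ge (zflip a) (- k).
Proof. apply CSeries_ext; intros n; unfold zflip; f_equal; lia. Qed.

Lemma sum_ge_rec a k : summable a -> sum_ge a k = a k + sum_ge a (k + 1).
Proof.
  intros H; unfold sum_ge; rewrite CSeries_incr by now apply summable_ge.
  f_equal; [f_equal; lia | apply CSeries_ext; intros n; f_equal; lia].
Qed.

Lemma sum_le_rec a k : summable a -> sum_le a k = a k + sum_le a (k - 1).
Proof.
  intros H; rewrite !sum_le_flip, sum_ge_rec by now apply summable_flip.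
  unfold zflip at 1; f_equal; f_equal; lia.
Qed.

Lemma sumZ_ext a b : (forall k, a k = b k) -> sumZ a = sumZ b.
Proof. intros H; unfold sumZ, sum_ge, sum_le; f_equal; apply CSeries_ext; auto. Qed.

Lemma sumZ_plus a b : summable a -> summable b ->
  sumZ (fun k => a k + b k) = sumZ a + sumZ b.
Proof.
  intros Ha Hb; unfold sumZ; rewrite !sum_le_flip; unfold sum_ge, zflip.
  rewrite !CSeries_plus; [ring|..];
  first [exact (summable_ge _ Ha) | exact (summable_ge _ Hb)
        | exact (summable_ge _ (summable_flip Ha))
        | exact (summable_ge _ (summable_flip Hb))].
Qed.

Lemma sumZ_opp a : sumZ (fun k => - a k) = - sumZ a.
Proof.
  unfold sumZ; rewrite !sum_le_flip; unfold sum_ge, zflip.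
  rewrite !CSeries_opp; ring.
Qed.

(* Tends to 0 at +oo; [vanish (zflip a)] says the same at -oo. *)
Definition vanish (a : Z -> C) := is_lim_seq (fun n => Cmod (a (Z.of_nat n))) 0.

Lemma vanish_le a b (M : R) : (forall k, Cmod (b k) <= M * Cmod (a k))%R ->
  vanish a -> vanish b.
Proof.
  intros H Ha. unfold vanish.
  apply is_lim_seq_le_le with (u := fun _ => 0%R)
    (w := fun n => (M * Cmod (a (Z.of_nat n)))%R).
  - intros n; split; [apply Cmod_ge_0 | apply H].
  - apply is_lim_seq_const.
  - replace (Finite 0) with (Rbar_mult M 0) by (simpl; f_equal; ring).
    now apply is_lim_seq_scal_l.
Qed.

Lemma vanish_plus a b : vanish a -> vanish b -> vanish (fun k => a k + b k).
Proof.
  intros Ha Hb; unfold vanish.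
  apply is_lim_seq_le_le with (u := fun _ => 0%R)
    (w := fun n => (Cmod (a (Z.of_nat n)) + Cmod (b (Z.of_nat n)))%R).
  - intros n; split; [apply Cmod_ge_0 | apply Cmod_triangle].
  - apply is_lim_seq_const.
  - replace (Finite 0) with (Finite (0 + 0)) by (f_equal; ring).
    now apply is_lim_seq_plus'.
Qed.

Lemma vanish_opp a : vanish a -> vanish (fun k => - a k).
Proof. apply vanish_le with 1%R; intros k; rewrite Cmod_opp; lra. Qed.

Lemma vanish_minus a b : vanish a -> vanish b -> vanish (fun k => a k - b k).
Proof. intros; now apply vanish_plus, vanish_opp. Qed.

Lemma vanish_mulr a b : vanish a -> seq_bounded b -> vanish (fun k => a k * b k).
Proof.
  intros Ha [M HM]; apply (@vanish_le a _ M) with (2 := Ha); intros k.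
  rewrite Cmod_mult, Rmult_comm. apply Rmult_le_compat_r; auto using Cmod_ge_0.
Qed.

Lemma vanish_mull a b : seq_bounded a -> vanish b -> vanish (fun k => a k * b k).
Proof.
  intros [M HM] Hb; apply (@vanish_le b _ M) with (2 := Hb); intros k.
  rewrite Cmod_mult. apply Rmult_le_compat_r; auto using Cmod_ge_0.
Qed.

Lemma summable_vanish a : summable a -> vanish a.
Proof. intros [H _]; now apply ex_series_lim_0 in H. Qed.

Lemma vanish_parts a :
  is_lim_seq (fun n => Re (a (Z.of_nat n))) 0 ->
  is_lim_seq (fun n => Im (a (Z.of_nat n))) 0 -> vanish a.
Proof.
  intros H1 H2; unfold vanish.
  apply is_lim_seq_le_le with (u := fun _ => 0%R)
    (w := fun n => (Rabs (Re (a (Z.of_nat n))) + Rabs (Im (a (Z.of_nat n))))%R).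
  - intros n; split; [apply Cmod_ge_0 | apply Cmod_parts].
  - apply is_lim_seq_const.
  - replace (Finite 0) with (Finite (0 + 0)) by (f_equal; ring).
    apply is_lim_seq_abs_0 in H1; apply is_lim_seq_abs_0 in H2.
    now apply is_lim_seq_plus'.
Qed.

Lemma vanish_sub a : vanish a ->
  is_lim_seq (fun n => Re (a (Z.of_nat n))) 0 /\
  is_lim_seq (fun n => Im (a (Z.of_nat n))) 0.
Proof.
  intros H; split; apply is_lim_seq_abs_0;
  apply is_lim_seq_le_le with (u := fun _ => 0%R) (3 := H);
  try apply is_lim_seq_const; intros n; split; try apply Rabs_pos;
  [apply Re_le_Cmod | apply Im_le_Cmod].
Qed.

Lemma vanish_sum_ge a : summable a -> vanish (sum_ge a).
Proof.
  intros Ha.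
  assert (E : forall n, sum_ge a 0 =
    (sum_n (fun i => Re (a (Z.of_nat i))) n,
     sum_n (fun i => Im (a (Z.of_nat i))) n) + sum_ge a (Z.of_nat (S n))).
  { induction n.
    - rewrite sum_ge_rec, !sum_O by trivial. f_equal.
      change (Z.of_nat 0) with 0%Z. now destruct (a 0%Z).
    - rewrite !sum_Sn, IHn, (sum_ge_rec (Z.of_nat (S n)) Ha).
      replace (Z.of_nat (S n) + 1)%Z with (Z.of_nat (S (S n))) by lia.
      unfold plus; simpl. set (x := sum_ge a _).
      unfold Cplus; simpl; f_equal; unfold Re, Im; ring. }
  destruct Ha as [H1 _].
  destruct (ex_parts _ H1) as [H3 H4].
  apply Series_correct in H3; apply Series_correct in H4.
  apply vanish_parts; apply is_lim_seq_incr_1.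
  - apply is_lim_seq_ext with (fun n => Re (sum_ge a 0) -
      sum_n (fun i => Re (a (Z.of_nat i))) n)%R.
    { intros n; rewrite (E n); simpl; ring. }
    replace (Finite 0) with (Finite (Re (sum_ge a 0) - Re (sum_ge a 0)))
      by (f_equal; ring).
    apply is_lim_seq_minus'; [apply is_lim_seq_const|exact H3].
  - apply is_lim_seq_ext with (fun n => Im (sum_ge a 0) -
      sum_n (fun i => Im (a (Z.of_nat i))) n)%R.
    { intros n; rewrite (E n); simpl; ring. }
    replace (Finite 0) with (Finite (Im (sum_ge a 0) - Im (sum_ge a 0)))
      by (f_equal; ring).
    apply is_lim_seq_minus'; [apply is_lim_seq_const|exact H4].
Qed.

Lemma bounded_of_diff b d : summable d -> (forall k, b (k + 1)%Z = b k + d k) ->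
  seq_bounded b.
Proof.
  assert (K : forall u e : nat -> C, ex_series (fun n => Cmod (e n)) ->
    (forall n, u (S n) = u n + e n) ->
    exists M : R, forall n, (Cmod (u n) <= M)%R).
  { intros u e He Hu. exists (Cmod (u 0%nat) + Series (fun n => Cmod (e n)))%R.
    assert (B : forall n, (Cmod (u (S n)) <= Cmod (u 0%nat)
                + sum_n (fun n => Cmod (e n)) n)%R).
    { induction n; rewrite Hu; eapply Rle_trans; try apply Cmod_triangle.
      - rewrite sum_O; lra.
      - rewrite sum_Sn; unfold plus; simpl; lra. }
    assert (C0 : forall n, (sum_n (fun n => Cmod (e n)) n <=
                           Series (fun n => Cmod (e n)))%R).
    { intros n.
      apply (is_lim_seq_incr_compare (sum_n (fun n => Cmod (e n)))).
      - apply Series_correct; trivial.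
      - intros m; rewrite sum_Sn; unfold plus; simpl.
        generalize (Cmod_ge_0 (e (S m))); lra. }
    intros [|n].
    - generalize (C0 0%nat); rewrite sum_O. generalize (Cmod_ge_0 (e 0%nat)); lra.
    - generalize (B n) (C0 n); lra. }
  intros [H1 H2] Hb.
  destruct (K (fun n => b (Z.of_nat n)) (fun n => d (Z.of_nat n))) as [M1 HM1]; trivial.
  { intros n; rewrite <- Hb; f_equal; lia. }
  destruct (K (fun n => b (- Z.of_nat n)%Z) (fun n => - d (- Z.of_nat (S n))%Z))
    as [M2 HM2].
  { apply ex_series_incr_1 in H2; revert H2; apply ex_series_ext; intros n.
    now rewrite Cmod_opp. }
  { intros n. replace (- Z.of_nat n)%Z with (- Z.of_nat (S n) + 1)%Z by lia.
    rewrite Hb; ring. }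
  exists (Rmax M1 M2); intros k. destruct (Z_le_gt_dec 0 k).
  - rewrite <- (Z2Nat.id k) by lia. eapply Rle_trans; [apply HM1 | apply Rmax_l].
  - replace k with (- Z.of_nat (Z.to_nat (- k)))%Z by lia.
    eapply Rle_trans; [apply HM2 | apply Rmax_r].
Qed.

Lemma bounded_flip a : seq_bounded a -> seq_bounded (zflip a).
Proof. intros [M H]; exists M; intros k; apply H. Qed.

Lemma bounded_sum_ge a : summable a -> seq_bounded (sum_ge a).
Proof.
  intros H; apply bounded_of_diff with (fun k => - a k).
  - now apply summable_opp.
  - intros k; rewrite (sum_ge_rec k H); ring.
Qed.

Lemma bounded_sum_le a : summable a -> seq_bounded (sum_le a).
Proof.
  intros H; apply bounded_of_diff with (fun k => a (k + 1)%Z).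
  - now apply summable_S.
  - intros k; rewrite (sum_le_rec (k + 1) H).
    replace (k + 1 - 1)%Z with k by lia; ring.
Qed.

Lemma vanish_flip_sum_le a : summable a -> vanish (zflip (sum_le a)).
Proof.
  intros H; apply summable_flip, vanish_sum_ge in H; revert H.
  apply vanish_le with 1%R; intros k; unfold zflip at 1.
  rewrite sum_le_flip, Z.opp_involutive; lra.
Qed.

Lemma bounded_const c : seq_bounded (fun _ => c).
Proof. exists (Cmod c); intros; lra. Qed.

Lemma bounded_plus a b : seq_bounded a -> seq_bounded b -> seq_bounded (fun k => a k + b k).
Proof.
  intros [M H] [N K]; exists (M + N)%R; intros k.
  eapply Rle_trans; [apply Cmod_triangle | generalize (H k) (K k); lra].
Qed.

Lemma bounded_opp a : seq_bounded a -> seq_bounded (fun k => - a k).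
Proof. intros [M H]; exists M; intros k; now rewrite Cmod_opp. Qed.

Lemma bounded_mult a b : seq_bounded a -> seq_bounded b -> seq_bounded (fun k => a k * b k).
Proof.
  intros [M H] [N K]; exists (M * N)%R; intros k; rewrite Cmod_mult.
  apply Rmult_le_compat; auto using Cmod_ge_0.
Qed.

Lemma bounded_shift a (m : Z) : seq_bounded a -> seq_bounded (fun k => a (k + m)%Z).
Proof. intros [M H]; exists M; intros k; apply H. Qed.

Lemma bounded_summable a : summable a -> seq_bounded a.
Proof.
  intros H. apply bounded_of_diff with (fun k => a (k + 1)%Z - a k).
  - apply summable_minus; trivial; now apply summable_S.
  - intros; ring.
Qed.

Lemma sumZ_telescope a b : (forall k, a k = b (k + 1)%Z - b k) ->
  vanish b -> vanish (zflip b) -> sumZ a = 0.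
Proof.
  intros H Hp Hm.
  assert (K : forall u e : nat -> R, (forall n, e n = u (S n) - u n)%R ->
    is_lim_seq u 0 -> Series e = (- u 0%nat)%R).
  { intros u e He Hu; apply is_series_unique.
    change (is_lim_seq (sum_n e) (Finite (- u 0%nat))).
    apply is_lim_seq_ext with (fun n => u (S n) - u 0%nat)%R.
    - induction n; [rewrite sum_O; now rewrite He|].
      rewrite sum_Sn, <- IHn, He; unfold plus; simpl; ring.
    - replace (Finite (- u 0%nat)) with (Finite (0 - u 0%nat)) by (f_equal; ring).
      apply is_lim_seq_minus'; [now apply (is_lim_seq_incr_1 u) | apply is_lim_seq_const]. }
  destruct (vanish_sub Hp) as [Pr Pi]. destruct (vanish_sub Hm) as [Mr Mi].
  assert (E1 : sum_ge a 0 = - b 0%Z).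
  { unfold sum_ge, CSeries.
    rewrite (K (fun n => Re (b (Z.of_nat n)))); [|intros n; rewrite H|exact Pr].
    2:{ replace (0 + Z.of_nat n + 1)%Z with (Z.of_nat (S n)) by lia. reflexivity. }
    rewrite (K (fun n => Im (b (Z.of_nat n)))); [|intros n; rewrite H|exact Pi].
    2:{ replace (0 + Z.of_nat n + 1)%Z with (Z.of_nat (S n)) by lia. reflexivity. }
    reflexivity. }
  assert (E2 : sum_le a (-1) = b 0%Z).
  { unfold sum_le, CSeries.
    rewrite (K (fun n => - Re (b (- Z.of_nat n)%Z))%R); [|intros n; rewrite H|].
    2:{ replace (-1 - Z.of_nat n + 1)%Z with (- Z.of_nat n)%Z by lia.
        replace (-1 - Z.of_nat n)%Z with (- Z.of_nat (S n))%Z by lia.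
        unfold Cminus, Cplus, Copp, Re; cbn [fst snd]; ring. }
    2:{ replace (Finite 0) with (Rbar_opp 0) by (simpl; f_equal; ring).
        now apply (is_lim_seq_opp (fun n => Re (zflip b (Z.of_nat n)))). }
    rewrite (K (fun n => - Im (b (- Z.of_nat n)%Z))%R); [|intros n; rewrite H|].
    2:{ replace (-1 - Z.of_nat n + 1)%Z with (- Z.of_nat n)%Z by lia.
        replace (-1 - Z.of_nat n)%Z with (- Z.of_nat (S n))%Z by lia.
        unfold Cminus, Cplus, Copp, Im; cbn [fst snd]; ring. }
    2:{ replace (Finite 0) with (Rbar_opp 0) by (simpl; f_equal; ring).
        now apply (is_lim_seq_opp (fun n => Im (zflip b (Z.of_nat n)))). }
    simpl. rewrite !Ropp_involutive. now destruct (b 0%Z). }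
  unfold sumZ; rewrite E1, E2; ring.
Qed.

Lemma bounded_inv_dens p : phase_space p -> seq_bounded (fun k => / dens p k).
Proof.
  intros [[Hq Hr] Hd].
  assert (Hs : summable (fun k => snd (p k) * fst (p k)))
    by (apply summable_mulr; trivial; now apply bounded_summable).
  assert (K : forall x : nat -> C, is_lim_seq (fun n => Cmod (x n)) 0 ->
    (forall n, 1 - x n <> 0) -> exists M : R, forall n, (Cmod (/ (1 - x n)) <= M)%R).
  { intros x Hx Hn.
    apply is_lim_seq_spec in Hx.
    destruct (Hx (mkposreal (1 / 2) ltac:(lra))) as [N HN]; simpl in HN.
    assert (F : forall m, exists M : R, forall n, (n < m)%nat ->
                  (Cmod (/ (1 - x n)) <= M)%R).
    { induction m as [|m [M HM]]; [exists 0%R; lia|].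
      exists (Rmax M (Cmod (/ (1 - x m)))); intros n Hnm.
      destruct (Nat.eq_dec n m) as [->|]; [apply Rmax_r|].
      eapply Rle_trans; [apply HM; lia | apply Rmax_l]. }
    destruct (F N) as [M HM]. exists (Rmax M 2); intros n.
    destruct (Nat.lt_ge_cases n N) as [Hl|Hl].
    - eapply Rle_trans; [now apply HM | apply Rmax_l].
    - apply Rle_trans with 2%R; [|apply Rmax_r].
      specialize (HN n Hl). rewrite Rminus_0_r, Rabs_pos_eq in HN by apply Cmod_ge_0.
      rewrite Cmod_inv by trivial.
      assert (B : (1 / 2 <= Cmod (1 - x n))%R).
      { generalize (Cmod_triangle (1 - x n) (x n)).
        replace (1 - x n + x n) with (RtoC 1) by ring. rewrite Cmod_1; lra. }
      replace 2%R with (/ (1 / 2))%R by field. apply Rinv_le_contravar; lra. }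
  destruct (K (fun n => snd (p (Z.of_nat n)) * fst (p (Z.of_nat n)))) as [M1 H1].
  { exact (summable_vanish Hs). }
  { intros n; apply Hd. }
  destruct (K (fun n => snd (p (- Z.of_nat n)%Z) * fst (p (- Z.of_nat n)%Z))) as [M2 H2].
  { exact (summable_vanish (summable_flip Hs)). }
  { intros n; apply Hd. }
  exists (Rmax M1 M2); intros k. destruct (Z_le_gt_dec 0 k).
  - rewrite <- (Z2Nat.id k) by lia. eapply Rle_trans; [apply H1 | apply Rmax_l].
  - replace k with (- Z.of_nat (Z.to_nat (- k)))%Z by lia.
    eapply Rle_trans; [apply H2 | apply Rmax_r].
Qed.

Ltac bdd := first
  [ assumption
  | lazymatch goal with
    | |- seq_bounded (fun k => ?a (k + ?m)%Z) => apply (@bounded_shift a m); bdd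
    | |- seq_bounded (fun k => ?a (k - ?m)%Z) => apply (@bounded_shift a (- m)%Z); bdd
    | |- seq_bounded (fun k => @?a k + @?b k) => apply (@bounded_plus a b); bdd
    | |- seq_bounded (fun k => @?a k * @?b k) => apply (@bounded_mult a b); bdd
    | |- seq_bounded (fun k => - @?a k) => apply (@bounded_opp a); bdd
    end
  | apply bounded_const
  | apply bounded_summable; assumption ].

Ltac smb := first
  [ assumption
  | lazymatch goal with
    | |- summable (fun k => ?a (k + 1)%Z) => apply (@summable_S a); assumption
    | |- summable (fun k => ?a (k - 1)%Z) => apply (@summable_P a); assumption
    | |- summable (fun k => @?a k + @?b k) => apply (@summable_plus a b); smb
    | |- summable (fun k => @?a k - @?b k) => apply (@summable_minus a b); smb
    | |- summable (fun k => - @?a k) => apply (@summable_opp a); smb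
    | |- summable (fun k => @?a k * @?b k) =>
        first [ apply (@summable_mulr a b); [smb | solve [bdd]]
              | apply (@summable_mull a b); [solve [bdd] | smb] ]
    end ].

(* A discrete Green identity: the difference of the two summands telescopes. *)
Section Green.

Variables q r u v u' v' ic : Z -> C.
Hypotheses (Hq : summable q) (Hr : summable r) (Hu : summable u)
  (Hv : summable v) (Hu' : summable u') (Hv' : summable v').
Let d k := 1 - r k * q k.
Hypothesis Hd : forall k, d k * ic k = 1.
Hypothesis Hic : seq_bounded ic.

Let s k := (q k * u k - r k * v k) * ic k.
Let s' k := (q k * u' k - r k * v' k) * ic k.
Let m k := q k * u (k - 1)%Z - r k * v (k + 1)%Z.
Let n k := q k * u (k + 1)%Z - r k * v (k - 1)%Z.
Let t' k := q k * (u' (k + 1)%Z - u' (k - 1)%Z)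
            + r k * (v' (k + 1)%Z - v' (k - 1)%Z).

Variables S M N S' T' : Z -> C.
Hypotheses (HS : forall k, S k = s k + S (k + 1)%Z)
  (HM : forall k, M k = m k + M (k + 1)%Z)
  (HN : forall k, N k = n k + N (k + 1)%Z)
  (HS' : forall k, S' k = s' k + S' (k - 1)%Z)
  (HT' : forall k, T' k = t' k + T' (k - 1)%Z).
Hypotheses (BS : seq_bounded S) (BM : seq_bounded M) (BN : seq_bounded N)
  (BS' : seq_bounded S') (BT' : seq_bounded T').
Hypotheses (VS : vanish S) (VM : vanish M) (VN : vanish N)
  (VS' : vanish (zflip S')) (VT' : vanish (zflip T')).

(* Components of [Lplus] applied to (u, v), then of [Lminus] to (u', v'). *)
Let P1 k := u (k - 1)%Z - d k * r (k - 1)%Z * S k - r k * M k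
  + (u (k + 1)%Z + d k * r (k + 1)%Z * S (k + 1)%Z + r k * N (k + 1)%Z).
Let P2 k := v (k + 1)%Z - d k * q (k + 1)%Z * S (k + 1)%Z - q k * M (k + 1)%Z
  + (v (k - 1)%Z + d k * q (k - 1)%Z * S k + q k * N k).
Let Q1 k := u' (k + 1)%Z + u' (k - 1)%Z
  - d k * (r (k + 1)%Z * S' k - r (k - 1)%Z * S' (k - 1)%Z)
  - r k * T' k - r k * q k * u' (k - 1)%Z + (r k * r k) * v' (k + 1)%Z.
Let Q2 k := v' (k + 1)%Z + v' (k - 1)%Z
  + d k * (q (k + 1)%Z * S' k - q (k - 1)%Z * S' (k - 1)%Z)
  - q k * T' k + (q k * q k) * u' (k + 1)%Z - q k * r k * v' (k - 1)%Z.

Let h k := q (k - 1)%Z * u k + q k * u (k - 1)%Z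
           + (r (k - 1)%Z * v k + r k * v (k - 1)%Z).
Let h' k := q (k - 1)%Z * u' k + q k * u' (k - 1)%Z
           + (r (k - 1)%Z * v' k + r k * v' (k - 1)%Z).
Let z k := v (k - 1)%Z * u' k - u (k - 1)%Z * v' k
           + (u k * v' (k - 1)%Z - v k * u' (k - 1)%Z).
Let tau k := z k + S k * h' k - S k * T' (k - 1)%Z
             - S' (k - 1)%Z * (N k - M k) - S' (k - 1)%Z * h k.

Lemma green_telescope k :
  (P1 k * v' k - P2 k * u' k) * ic k - (u k * Q2 k - v k * Q1 k) * ic k
  = tau (k + 1)%Z - tau k.
Proof.
  assert (E : ic k <> 0).
  { intros E; generalize (Hd k); rewrite E, Cmult_0_r; intros K.
    apply RtoC_inj in K; lra. }
  assert (E' : d k <> 0).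
  { intros E'; generalize (Hd k); rewrite E', Cmult_0_l; intros K.
    apply RtoC_inj in K; lra. }
  assert (Ei : ic k = / d k).
  { transitivity (d k * ic k * / d k); [field; trivial | rewrite Hd; ring]. }
  unfold tau, P1, P2, Q1, Q2, z, h, h'.
  replace (k + 1 - 1)%Z with k by lia.
  rewrite (HS k), (HM k), (HN k).
  replace (S' (k - 1)%Z) with (S' k - s' k) by (rewrite (HS' k); ring).
  replace (T' (k - 1)%Z) with (T' k - t' k) by (rewrite (HT' k); ring).
  unfold s, s', m, n, t'. rewrite Ei. unfold d in *.
  field. exact E'.
Qed.

Lemma vanish_tau : vanish tau /\ vanish (zflip tau).
Proof.
  assert (Hz : summable z) by (unfold z; smb).
  assert (Hh : summable h) by (unfold h; smb).
  assert (Hh' : summable h') by (unfold h'; smb).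
  assert (Fl : forall a, summable a -> vanish (zflip a))
    by (intros a Ha; apply summable_vanish, summable_flip, Ha).
  assert (BS1 : seq_bounded (fun k => S' (k - 1)%Z)) by bdd.
  assert (BT1 : seq_bounded (fun k => T' (k - 1)%Z)) by bdd.
  assert (VS1 : vanish (zflip (fun k => S' (k - 1)%Z))).
  { apply is_lim_seq_incr_1 in VS'; revert VS'; apply is_lim_seq_ext; intros i.
    unfold zflip; do 2 f_equal; lia. }
  assert (VT1 : vanish (zflip (fun k => T' (k - 1)%Z))).
  { apply is_lim_seq_incr_1 in VT'; revert VT'; apply is_lim_seq_ext; intros i.
    unfold zflip; do 2 f_equal; lia. }
  assert (BSh : seq_bounded h) by now apply bounded_summable.
  assert (BSh' : seq_bounded h') by now apply bounded_summable.
  unfold tau; clearbody z h h'. split.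
  - repeat apply vanish_minus; [apply vanish_plus| | |].
    + now apply summable_vanish.
    + now apply vanish_mulr.
    + now apply vanish_mulr.
    + apply vanish_mull; trivial. now apply vanish_minus.
    + apply vanish_mull; trivial. now apply summable_vanish.
  - change (vanish (fun k => zflip z k + zflip S k * zflip h' k
      - zflip S k * zflip (fun k => T' (k - 1)%Z) k
      - zflip (fun k => S' (k - 1)%Z) k * (zflip N k - zflip M k)
      - zflip (fun k => S' (k - 1)%Z) k * zflip h k)).
    repeat apply vanish_minus; [apply vanish_plus| | |].
    + now apply Fl.
    + apply vanish_mull; [now apply bounded_flip | now apply Fl].
    + apply vanish_mull; [now apply bounded_flip | trivial].
    + apply vanish_mulr; trivial.
      apply bounded_plus; [|apply bounded_opp]; now apply bounded_flip.
    + apply vanish_mulr; trivial. now apply bounded_flip.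
Qed.

Lemma green :
  sumZ (fun k => (P1 k * v' k - P2 k * u' k) * ic k)
  = sumZ (fun k => (u k * Q2 k - v k * Q1 k) * ic k).
Proof.
  assert (Bd : seq_bounded d) by (unfold d, Cminus; bdd).
  assert (SP1 : summable P1) by (unfold P1; smb).
  assert (SP2 : summable P2) by (unfold P2; smb).
  assert (SQ1 : summable Q1) by (unfold Q1; smb).
  assert (SQ2 : summable Q2) by (unfold Q2; smb).
  set (a := fun k => (P1 k * v' k - P2 k * u' k) * ic k).
  set (b := fun k => (u k * Q2 k - v k * Q1 k) * ic k).
  assert (Sa : summable a) by (unfold a; smb).
  assert (Sb : summable b) by (unfold b; smb).
  assert (E : sumZ (fun k => a k + - b k) = 0).
  { destruct vanish_tau; now apply sumZ_telescope with tau; [intros k; apply green_telescope|..]. }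
  rewrite sumZ_plus, sumZ_opp in E; trivial; [|now apply summable_opp].
  replace (sumZ a) with (sumZ a + - sumZ b + sumZ b) by ring. rewrite E; ring.
Qed.

End Green.

(* [Lminus p] is the conjugate by [sigma3] (which is its own inverse) of the
   adjoint of [Lplus p]. *)
Lemma Lminus_adjoint (p w w' : field) :
  phase_space p -> decaying w -> decaying w' ->
  form p (Lplus p w) w' = form p w (sigma3 (Lminus p (sigma3 w'))).
Proof.
  intros Hp Hw Hw'. pose proof (bounded_inv_dens Hp) as Hic.
  destruct Hp as [[Hq Hr] Hd], Hw as [Hu Hv], Hw' as [Hu' Hv'].
  set (q := fun k => fst (p k)) in *. set (r := fun k => snd (p k)) in *.
  set (u := fun k => fst (w k)) in *. set (v := fun k => snd (w k)) in *.
  set (u' := fun k => fst (w' k)) in *.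
  set (v0 := fun k => snd (w' k)) in *. set (v' := fun k => - v0 k).
  set (ic := fun k => / dens p k) in *.
  assert (Hv1 : summable v') by now apply summable_opp.
  assert (Hs : summable (s_ p w)).
  { apply summable_ext with (fun k => (q k * u k - r k * v k) * ic k);
    [reflexivity | smb]. }
  assert (Hs' : summable (s_ p (sigma3 w'))).
  { apply summable_ext with (fun k => (q k * u' k - r k * v' k) * ic k);
    [reflexivity | smb]. }
  assert (Ht' : summable (t_ p (sigma3 w'))).
  { apply summable_ext with (fun k => q k * (u' (k + 1)%Z - u' (k - 1)%Z)
            + r k * (v' (k + 1)%Z - v' (k - 1)%Z));
    [reflexivity | smb]. }
  set (m := fun k => q k * u (k - 1)%Z - r k * v (k + 1)%Z).
  set (n := fun k => q k * u (k + 1)%Z - r k * v (k - 1)%Z).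
  assert (Hm : summable m) by (unfold m; smb).
  assert (Hn : summable n) by (unfold n; smb).
  assert (Hi : forall k, (1 - r k * q k) * ic k = 1)
    by (intros k; apply Cinv_r, Hd).
  pose proof (@green q r u v u' v' ic Hq Hr Hu Hv Hu' Hv1 Hi Hic
    (sum_ge (s_ p w)) (sum_ge m) (sum_ge n)
    (sum_le (s_ p (sigma3 w'))) (sum_le (t_ p (sigma3 w')))
    (fun k => sum_ge_rec k Hs) (fun k => sum_ge_rec k Hm)
    (fun k => sum_ge_rec k Hn)
    (fun k => sum_le_rec k Hs') (fun k => sum_le_rec k Ht')
    (bounded_sum_ge Hs) (bounded_sum_ge Hm) (bounded_sum_ge Hn)
    (bounded_sum_le Hs') (bounded_sum_le Ht')
    (vanish_sum_ge Hs) (vanish_sum_ge Hm) (vanish_sum_ge Hn)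
    (vanish_flip_sum_le Hs') (vanish_flip_sum_le Ht')) as G.
  unfold form. rewrite <- !sumZ_opp.
  etransitivity; [etransitivity; [|exact G]|]; apply sumZ_ext; intros k;
  unfold Lplus, fadd, L, Linv, Lminus, sigma3, Cdiv; cbn [fst snd];
  fold (ic k); unfold m, n, v', v0, u', u, v, q, r, dens; cbn [fst snd]; ring.
Qed.

(* Main.v *)
Require Import Defs.
From Stdlib Require Import Reals ZArith List Lra Lia FunctionalExtensionality.
From Coquelicot Require Import Coquelicot.

(** Write [X = swap p] for the vector [(r_k, q_k)].  A direct computation gives
    [J nabla H_0 = rot (i X)], and [Rop] is [Lplus + Lminus] conjugated by
    [rot].  So the equation of index [n] says that the velocity of
    [(- r_k, q_k)] is [i (Lplus + Lminus)^n X], and everything follows from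
    [Lminus w = Lplus w] for [w = Lplus^n X]: the right-hand side is then
    [i 2^n Lplus^n X].

    For every decaying [w], the difference [Lplus w - Lminus w] is
    [skew w X] times [Linv X - L X] plus [skew w (Linv X - L X)] times [X],
    where [skew] is the antisymmetric form [form p w (sigma3 w')].  It is
    therefore enough that [w] be orthogonal for [skew] to all [L^a X], [a] in
    [Z] (predicate [isotropic], lemma [Lminus_isotropic]).

    The operator [L] is self-adjoint for [skew] up to the rank two correction
    [skew w' X * skew w (L X) + skew w' (L X) * skew w X] (lemma [skew_L]).
    Given this, an induction on [a >= 0] shows that [skew (L^a X) X = 0]: the
    corrections are products that contain an earlier value, so this number equals
    [skew X (L^a X)], its own opposite (lemma [skew_iter_L]).  Negative
    exponents are reached by the symmetry that exchanges [q] with [r] and [L]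
    with [Linv].  Self-adjointness, now without correction, then shows that
    isotropic vectors are stable under [L], and also under [Linv], because
    [L] and [Linv] are inverse to each other on decaying vectors.

    That last fact also places the equations in the inverse scattering family:
    a polynomial in [Lplus = L + Linv] is a Laurent polynomial in [L]. *)

Set Implicit Arguments.
Open Scope C_scope.

(** * Sums over [Z] *)

Lemma vanish_const_0 c : vanish (fun _ => c) -> c = 0.
Proof.
  intros H; apply is_lim_seq_unique in H; rewrite Lim_seq_const in H.
  apply Cmod_eq_0; congruence.
Qed.

Lemma vanish_ext a b : (forall k, a k = b k) -> vanish a -> vanish b.
Proof. intros E; apply is_lim_seq_ext; intros n; now rewrite E. Qed.

Lemma shift_invariant (e : Z -> C) :
  (forall k, e k = e (k + 1)%Z) -> forall k, e k = e 0%Z.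
Proof.
  intros H; apply (Z.order_induction (fun k => e k = e 0%Z)) with (z := 0%Z).
  - intros x y ->; reflexivity.
  - reflexivity.
  - intros k _ E. now rewrite <- E, (H k).
  - intros k _ E. now rewrite (H k).
Qed.

(** The difference of [b] and the tail sums is shift invariant and vanishes
    at [+oo].  Every closed form of a tail sum below is obtained by guessing [b]
    and checking its recursion. *)
Lemma sum_ge_unique a b : summable a -> vanish b ->
  (forall k, b k = a k + b (k + 1)%Z) -> forall k, sum_ge a k = b k.
Proof.
  intros Ha Hb Hrec k.
  assert (E : forall j, sum_ge a j - b j = sum_ge a 0 - b 0%Z).
  { apply (shift_invariant (fun j => sum_ge a j - b j)); intros j.
    rewrite (sum_ge_rec j Ha), (Hrec j); ring. }
  assert (E0 : sum_ge a 0 - b 0%Z = 0).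
  { apply vanish_const_0, (vanish_ext _ E), vanish_minus; trivial.
    now apply vanish_sum_ge. }
  replace (b k) with (sum_ge a k - (sum_ge a k - b k)) by ring.
  rewrite E, E0; ring.
Qed.

Lemma sum_ge_ext a b k : (forall j, a j = b j) -> sum_ge a k = sum_ge b k.
Proof. intros E; apply CSeries_ext; intros n; apply E. Qed.

Lemma sum_ge_plus a b k : summable a -> summable b ->
  sum_ge (fun j => a j + b j) k = sum_ge a k + sum_ge b k.
Proof.
  intros Ha Hb.
  apply (@sum_ge_unique (fun j => a j + b j) (fun j => sum_ge a j + sum_ge b j)).
  - now apply summable_plus.
  - now apply vanish_plus; apply vanish_sum_ge.
  - intros j; rewrite (sum_ge_rec j Ha), (sum_ge_rec j Hb); ring.
Qed.

Lemma summable_scal c a : summable a -> summable (fun k => c * a k).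
Proof. apply summable_mull, bounded_const. Qed.

Lemma summable_mult a b : summable a -> summable b -> summable (fun k => a k * b k).
Proof. intros Ha Hb; apply summable_mulr; trivial; now apply bounded_summable. Qed.

Lemma sum_ge_scal c a k : summable a ->
  sum_ge (fun j => c * a j) k = c * sum_ge a k.
Proof.
  intros Ha.
  apply (@sum_ge_unique (fun j => c * a j) (fun j => c * sum_ge a j)).
  - now apply summable_scal.
  - apply vanish_mull; [apply bounded_const | now apply vanish_sum_ge].
  - intros j; rewrite (sum_ge_rec j Ha); ring.
Qed.

Lemma sumZ_scal c a : summable a -> sumZ (fun j => c * a j) = c * sumZ a.
Proof.
  intros Ha; unfold sumZ; rewrite !sum_le_flip, sum_ge_scal by trivial.
  unfold zflip at 1; rewrite (@sum_ge_scal c (zflip a)) by now apply summable_flip.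
  ring.
Qed.

Lemma sumZ_split a k : summable a -> sumZ a = sum_le a k + sum_ge a (k + 1).
Proof.
  intros Ha.
  rewrite (shift_invariant (fun j => sum_le a j + sum_ge a (j + 1))).
  - unfold sumZ. rewrite (sum_le_rec 0 Ha), (sum_ge_rec 0 Ha).
    change (0 - 1)%Z with (-1)%Z; ring.
  - intros j. rewrite (sum_ge_rec (j + 1) Ha), (sum_le_rec (j + 1) Ha).
    replace (j + 1 - 1)%Z with j by lia; ring.
Qed.

Lemma CSeries_0 : CSeries (fun _ => 0) = 0.
Proof.
  unfold CSeries; simpl.
  rewrite (Series_ext _ (fun n => 0 * 0)%R), Series_scal_l by (intros; ring).
  now rewrite Rmult_0_l.
Qed.

Lemma sumZ_single k c :
  summable (fun j => if Z.eq_dec j k then c else 0) /\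
  sumZ (fun j => if Z.eq_dec j k then c else 0) = c.
Proof.
  set (a := fun j => if Z.eq_dec j k then c else 0).
  assert (Ha : summable a).
  { assert (K : forall f : nat -> C, (exists N, forall n, (N <= n)%nat -> f n = 0) ->
              ex_series (fun n => Cmod (f n))).
    { intros f [N HN]. apply (ex_series_incr_n _ N).
      exists 0%R; apply (is_series_ext (fun _ => 0%R)).
      { intros n; rewrite HN by lia. now rewrite Cmod_0. }
      change (is_lim_seq (sum_n (fun _ => 0%R)) 0).
      apply (is_lim_seq_ext (fun _ => 0%R)); [|apply is_lim_seq_const].
      intros n; now rewrite sum_n_const, Rmult_0_r. }
    split; apply K; exists (S (Z.abs_nat k)); intros n Hn; unfold a;
    destruct (Z.eq_dec _ k); trivial; lia. }
  split; trivial.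
  rewrite (@sumZ_split a k Ha), (sum_le_rec k Ha).
  assert (E1 : sum_le a (k - 1) = 0).
  { rewrite <- CSeries_0; apply CSeries_ext; intros n; unfold a.
    destruct (Z.eq_dec _ k); trivial; lia. }
  assert (E2 : sum_ge a (k + 1) = 0).
  { rewrite <- CSeries_0; apply CSeries_ext; intros n; unfold a.
    destruct (Z.eq_dec _ k); trivial; lia. }
  rewrite E1, E2; unfold a; destruct (Z.eq_dec k k); [ring | lia].
Qed.

(** * The operators [L] and [Linv] *)

Lemma field_ext (w w' : field) : (forall k, fst (w k) = fst (w' k)) ->
  (forall k, snd (w k) = snd (w' k)) -> w = w'.
Proof.
  intros H1 H2; apply functional_extensionality; intros k.
  rewrite (surjective_pairing (w k)), (surjective_pairing (w' k)).
  now rewrite H1, H2.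
Qed.

Lemma swap_swap w : swap (swap w) = w.
Proof. now apply field_ext. Qed.

Lemma dens_swap p k : dens (swap p) k = dens p k.
Proof. unfold dens, swap; simpl; ring. Qed.

Lemma decaying_swap w : decaying w -> decaying (swap w).
Proof. intros [H1 H2]; now split. Qed.

Lemma decaying_fadd w w' : decaying w -> decaying w' -> decaying (fadd w w').
Proof. intros [H1 H2] [H3 H4]; split; now apply summable_plus. Qed.

Lemma decaying_fscal c w : decaying w -> decaying (fscal c w).
Proof. intros [H1 H2]; split; now apply summable_scal. Qed.

Lemma phase_space_swap p : phase_space p -> phase_space (swap p).
Proof.
  intros [H Hd]; split; [now apply decaying_swap|].
  intros k; rewrite dens_swap; apply Hd.
Qed.

(** The sequences [m_] and [n_] are summed in the last terms of [L] and
    [Linv]; the difference [n_ - m_] is [t_]. *)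
Definition m_ (p w : field) (j : Z) : C :=
  fst (p j) * fst (w (j - 1)%Z) - snd (p j) * snd (w (j + 1)%Z).

Definition n_ (p w : field) (j : Z) : C :=
  fst (p j) * fst (w (j + 1)%Z) - snd (p j) * snd (w (j - 1)%Z).

Lemma m_swap p w j : m_ (swap p) (swap w) j = - n_ p w j.
Proof. unfold m_, n_, swap; simpl; ring. Qed.

Lemma summable_s p w : phase_space p -> decaying w -> summable (s_ p w).
Proof.
  intros Hp [Hu Hv]; pose proof (bounded_inv_dens Hp) as Hic.
  destruct Hp as [[Hq Hr] _].
  apply summable_mulr; [|exact Hic]. now apply summable_minus; apply summable_mult.
Qed.

Lemma summable_m p w : phase_space p -> decaying w -> summable (m_ p w).
Proof.
  intros [[Hq Hr] _] [Hu Hv].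
  exact (summable_minus (summable_mult Hq (summable_P Hu))
                        (summable_mult Hr (summable_S Hv))).
Qed.

Lemma summable_n p w : phase_space p -> decaying w -> summable (n_ p w).
Proof.
  intros [[Hq Hr] _] [Hu Hv].
  exact (summable_minus (summable_mult Hq (summable_S Hu))
                        (summable_mult Hr (summable_P Hv))).
Qed.

Lemma bounded_dens p : phase_space p -> seq_bounded (dens p).
Proof.
  intros [[Hq Hr] _]. apply bounded_plus; [apply bounded_const|].
  apply bounded_opp, bounded_mult; now apply bounded_summable.
Qed.

Lemma decaying_L p w : phase_space p -> decaying w -> decaying (L p w).
Proof.
  intros Hp Hw. pose proof (summable_s Hp Hw) as Hs.
  pose proof (summable_m Hp Hw) as Hm. pose proof (bounded_dens Hp) as Hd.
  pose proof (bounded_sum_ge Hs) as BS. pose proof (bounded_sum_ge Hm) as BM.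
  destruct Hp as [[Hq Hr] _], Hw as [Hu Hv].
  set (q := fun k => fst (p k)) in *. set (r := fun k => snd (p k)) in *.
  set (u := fun k => fst (w k)) in *. set (v := fun k => snd (w k)) in *.
  set (d := dens p) in *. set (S := sum_ge (s_ p w)) in *.
  set (M := sum_ge (m_ p w)) in *. split.
  - change (summable (fun k => u (k - 1)%Z - d k * r (k - 1)%Z * S k - r k * M k)).
    smb.
  - change (summable (fun k => v (k + 1)%Z - d k * q (k + 1)%Z * S (k + 1)%Z
                               - q k * M (k + 1)%Z)).
    smb.
Qed.

(** The exchange of [q] with [r] and of [u] with [v] turns [s_] into [- s_]
    and [m_] into [- n_], hence [L] into [Linv].  Facts about [Linv] are
    deduced from those about [L] in this way. *)
Lemma Linv_swap p w : Linv p w = swap (L (swap p) (swap w)).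
Proof.
  assert (Es : forall k, sum_ge (s_ (swap p) (swap w)) k = - sum_ge (s_ p w) k).
  { intros k; unfold sum_ge; rewrite <- CSeries_opp; apply CSeries_ext; intros n.
    unfold s_; rewrite dens_swap; unfold swap, Cdiv; simpl; ring. }
  assert (Em : forall k, sum_ge (m_ (swap p) (swap w)) k = - sum_ge (n_ p w) k).
  { intros k; unfold sum_ge; rewrite <- CSeries_opp; apply CSeries_ext; intros i.
    apply m_swap. }
  apply field_ext; intros k.
  - change (fst (w (k + 1)%Z) + dens p k * snd (p (k + 1)%Z) * sum_ge (s_ p w) (k + 1)
            + snd (p k) * sum_ge (n_ p w) (k + 1)
          = fst (w (k + 1)%Z)
            - dens (swap p) k * snd (p (k + 1)%Z) * sum_ge (s_ (swap p) (swap w)) (k + 1)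
            - snd (p k) * sum_ge (m_ (swap p) (swap w)) (k + 1)).
    rewrite Es, Em, dens_swap; ring.
  - change (snd (w (k - 1)%Z) + dens p k * fst (p (k - 1)%Z) * sum_ge (s_ p w) k
            + fst (p k) * sum_ge (n_ p w) k
          = snd (w (k - 1)%Z)
            - dens (swap p) k * fst (p (k - 1)%Z) * sum_ge (s_ (swap p) (swap w)) k
            - fst (p k) * sum_ge (m_ (swap p) (swap w)) k).
    rewrite Es, Em, dens_swap; ring.
Qed.

Lemma decaying_Linv p w : phase_space p -> decaying w -> decaying (Linv p w).
Proof.
  intros Hp Hw; rewrite Linv_swap.
  now apply decaying_swap, decaying_L; [apply phase_space_swap|apply decaying_swap].
Qed.

Lemma L_fadd p w w' : phase_space p -> decaying w -> decaying w' ->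
  L p (fadd w w') = fadd (L p w) (L p w').
Proof.
  intros Hp Hw Hw'.
  assert (Es : forall k, sum_ge (s_ p (fadd w w')) k
                         = sum_ge (s_ p w) k + sum_ge (s_ p w') k).
  { intros k; rewrite <- sum_ge_plus by now apply summable_s.
    apply sum_ge_ext; intros j; unfold s_, fadd, Cdiv; simpl; ring. }
  assert (Em : forall k, sum_ge (m_ p (fadd w w')) k
                         = sum_ge (m_ p w) k + sum_ge (m_ p w') k).
  { intros k; rewrite <- sum_ge_plus by now apply summable_m.
    apply sum_ge_ext; intros j; unfold m_, fadd; simpl; ring. }
  apply field_ext; intros k; unfold L; cbn [fst snd];
  change (fun j => fst (p j) * fst (fadd w w' (j - 1)%Z)
                   - snd (p j) * snd (fadd w w' (j + 1)%Z)) with (m_ p (fadd w w'));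
  rewrite Es, Em; unfold fadd, m_; cbn [fst snd]; ring.
Qed.

Lemma L_fscal p c w : phase_space p -> decaying w ->
  L p (fscal c w) = fscal c (L p w).
Proof.
  intros Hp Hw.
  assert (Es : forall k, sum_ge (s_ p (fscal c w)) k = c * sum_ge (s_ p w) k).
  { intros k; rewrite <- sum_ge_scal by now apply summable_s.
    apply sum_ge_ext; intros j; unfold s_, fscal, Cdiv; simpl; ring. }
  assert (Em : forall k, sum_ge (m_ p (fscal c w)) k = c * sum_ge (m_ p w) k).
  { intros k; rewrite <- sum_ge_scal by now apply summable_m.
    apply sum_ge_ext; intros j; unfold m_, fscal; simpl; ring. }
  apply field_ext; intros k; unfold L; cbn [fst snd];
  change (fun j => fst (p j) * fst (fscal c w (j - 1)%Z)
                   - snd (p j) * snd (fscal c w (j + 1)%Z)) with (m_ p (fscal c w));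
  rewrite Es, Em; unfold fscal, m_; cbn [fst snd]; ring.
Qed.

Lemma Linv_fadd p w w' : phase_space p -> decaying w -> decaying w' ->
  Linv p (fadd w w') = fadd (Linv p w) (Linv p w').
Proof.
  intros Hp Hw Hw'; rewrite !Linv_swap.
  change (swap (fadd w w')) with (fadd (swap w) (swap w')).
  rewrite L_fadd; auto using phase_space_swap, decaying_swap.
Qed.

Lemma Linv_fscal p c w : phase_space p -> decaying w ->
  Linv p (fscal c w) = fscal c (Linv p w).
Proof.
  intros Hp Hw; rewrite !Linv_swap.
  change (swap (fscal c w)) with (fscal c (swap w)).
  rewrite L_fscal; auto using phase_space_swap, decaying_swap.
Qed.

(** The first sum has zero summands, as [q_j r_j - r_j q_j = 0]; the second
    one telescopes to [q_k r_(k-1)]. *)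
Lemma L_potential p : phase_space p ->
  L p (swap p)
  = fun k => (dens p k * snd (p (k - 1)%Z), dens p k * fst (p (k + 1)%Z)).
Proof.
  intros Hp.
  assert (Es : forall k, sum_ge (s_ p (swap p)) k = 0).
  { apply (@sum_ge_unique _ (fun _ => 0)).
    - apply summable_s; trivial. apply decaying_swap, Hp.
    - unfold vanish; rewrite Cmod_0; apply is_lim_seq_const.
    - intros k; unfold s_, swap, Cdiv; simpl; ring. }
  assert (Em : forall k, sum_ge (m_ p (swap p)) k = fst (p k) * snd (p (k - 1)%Z)).
  { apply (@sum_ge_unique _ (fun k => fst (p k) * snd (p (k - 1)%Z))).
    - apply summable_m; trivial. apply decaying_swap, Hp.
    - destruct Hp as [[Hq Hr] _].
      exact (summable_vanish (summable_mult Hq (summable_P Hr))).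
    - intros k; unfold m_, swap; simpl. replace (k + 1 - 1)%Z with k by lia. ring. }
  apply field_ext; intros k; unfold L; cbn [fst snd];
  change (fun j => fst (p j) * fst (swap p (j - 1)%Z)
                   - snd (p j) * snd (swap p (j + 1)%Z)) with (m_ p (swap p));
  rewrite Es, Em; unfold dens, swap; cbn [fst snd];
  replace (k + 1 - 1)%Z with k by lia; ring.
Qed.

(** [Linv] is defined by a formula, so that this needs a proof: the sums over
    the image [Linv p w] have closed forms in the sums over [w]. *)
Lemma L_Linv p w : phase_space p -> decaying w -> L p (Linv p w) = w.
Proof.
  intros Hp Hw. pose proof (decaying_Linv Hp Hw) as Hw'.
  pose proof (summable_n Hp Hw) as Hn.
  pose proof (summable_s Hp Hw) as Hs.
  assert (Ed : forall k, dens p k <> 0) by apply Hp.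
  assert (HS : forall k, sum_ge (s_ p w) k = s_ p w k + sum_ge (s_ p w) (k + 1))
    by (intros k; now apply sum_ge_rec).
  assert (HN : forall k, sum_ge (n_ p w) k = n_ p w k + sum_ge (n_ p w) (k + 1))
    by (intros k; now apply sum_ge_rec).
  pose proof (vanish_sum_ge Hs) as VS. pose proof (vanish_sum_ge Hn) as VN.
  assert (Bq : seq_bounded (fun k => fst (p k))) by apply bounded_summable, Hp.
  assert (Br : seq_bounded (fun k => snd (p k))) by apply bounded_summable, Hp.
  assert (W : forall k, Linv p w k =
    ( fst (w (k + 1)%Z) + dens p k * snd (p (k + 1)%Z) * sum_ge (s_ p w) (k + 1)
        + snd (p k) * sum_ge (n_ p w) (k + 1),
      snd (w (k - 1)%Z) + dens p k * fst (p (k - 1)%Z) * sum_ge (s_ p w) k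
        + fst (p k) * sum_ge (n_ p w) k)) by reflexivity.
  set (S := sum_ge (s_ p w)) in *. set (N := sum_ge (n_ p w)) in *.
  assert (Es : forall k, sum_ge (s_ p (Linv p w)) k
                         = N k - fst (p (k - 1)%Z) * snd (p k) * S k).
  { apply (@sum_ge_unique _ (fun k => N k - fst (p (k - 1)%Z) * snd (p k) * S k)).
    - now apply summable_s.
    - apply vanish_minus; trivial. apply vanish_mull; trivial.
      apply (@bounded_mult (fun k => fst (p (k - 1)%Z))); trivial.
      now apply (@bounded_shift (fun k => fst (p k)) (-1)).
    - intros k. unfold s_ at 1; rewrite W; cbn [fst snd].
      replace (k + 1 - 1)%Z with k by lia.
      rewrite (HN k), (HS k). unfold n_, s_. specialize (Ed k).
      unfold dens in *. field; trivial. }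
  assert (Em : forall k, sum_ge (m_ p (Linv p w)) k
     = fst (p k) * snd (p (k - 1)%Z) * N k
       + (1 - (1 - dens p k) * (1 - dens p (k - 1)%Z)) * S k).
  { apply (@sum_ge_unique _ (fun k => fst (p k) * snd (p (k - 1)%Z) * N k
       + (1 - (1 - dens p k) * (1 - dens p (k - 1)%Z)) * S k)).
    - now apply summable_m.
    - apply vanish_plus; apply vanish_mull; trivial.
      + apply (@bounded_mult (fun k => fst (p k))); trivial.
        now apply (@bounded_shift (fun k => snd (p k)) (-1)).
      + pose proof (@bounded_shift (dens p) (-1) (bounded_dens Hp)) as Bd1.
        pose proof (bounded_dens Hp) as Bd0.
        apply (@bounded_plus (fun _ => RtoC 1)); [apply bounded_const|].
        apply (@bounded_opp (fun k => (1 - dens p k) * (1 - dens p (k - 1)%Z))).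
        apply (@bounded_mult (fun k => 1 - dens p k) (fun k => 1 - dens p (k - 1)%Z));
        (apply (@bounded_plus (fun _ => RtoC 1)); [apply bounded_const|]);
        now apply bounded_opp.
    - intros k. unfold m_ at 1; rewrite !W; cbn [fst snd].
      replace (k + 1 - 1)%Z with k by lia. replace (k - 1 + 1)%Z with k by lia.
      rewrite (HN k), (HS k). unfold n_, s_. specialize (Ed k).
      unfold dens in *. field; trivial. }
  apply field_ext; intros k; unfold L; cbn [fst snd];
  change (fun j => fst (p j) * fst (Linv p w (j - 1)%Z)
                   - snd (p j) * snd (Linv p w (j + 1)%Z)) with (m_ p (Linv p w));
  rewrite Es, Em, W; cbn [fst snd];
  replace (k + 1 - 1)%Z with k by lia; replace (k - 1 + 1)%Z with k by lia;
  unfold dens; ring.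
Qed.

Lemma Linv_L p w : phase_space p -> decaying w -> Linv p (L p w) = w.
Proof.
  intros Hp Hw.
  assert (E : swap (L p w) = Linv (swap p) (swap w))
    by now rewrite Linv_swap, !swap_swap.
  rewrite Linv_swap, E, L_Linv; [apply swap_swap|..];
  auto using phase_space_swap, decaying_swap.
Qed.

(** * The antisymmetric form and the adjoint of [L] *)

(** This is [form p w (sigma3 w')].  The conjugation by [sigma3] that occurs
    in [Lminus] is absorbed in it: [Lminus p] is the adjoint of [Lplus p] for
    [skew p], which is antisymmetric where [form p] is symmetric. *)
Definition skew (p w w' : field) : C :=
  sumZ (fun k => (fst (w k) * snd (w' k) - snd (w k) * fst (w' k)) / dens p k).

Lemma summable_skew p w w' : phase_space p -> decaying w -> decaying w' ->
  summable (fun k => (fst (w k) * snd (w' k) - snd (w k) * fst (w' k)) / dens p k).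
Proof.
  intros Hp [Hu Hv] [Hu' Hv'].
  apply summable_mulr; [|now apply bounded_inv_dens].
  now apply summable_minus; apply summable_mult.
Qed.

Lemma skew_antisym p w w' : skew p w w' = - skew p w' w.
Proof.
  unfold skew; rewrite <- sumZ_opp; apply sumZ_ext; intros k; unfold Cdiv; ring.
Qed.

Lemma skew_fadd_l p w1 w2 w' : phase_space p ->
  decaying w1 -> decaying w2 -> decaying w' ->
  skew p (fadd w1 w2) w' = skew p w1 w' + skew p w2 w'.
Proof.
  intros Hp H1 H2 H'; unfold skew.
  rewrite <- sumZ_plus by now apply summable_skew.
  apply sumZ_ext; intros k; unfold fadd, Cdiv; simpl; ring.
Qed.

Lemma skew_fscal_l p c w w' : phase_space p -> decaying w -> decaying w' ->
  skew p (fscal c w) w' = c * skew p w w'.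
Proof.
  intros Hp H H'; unfold skew.
  rewrite <- sumZ_scal by now apply summable_skew.
  apply sumZ_ext; intros k; unfold fscal, Cdiv; simpl; ring.
Qed.

Lemma skew_fadd_r p w w1 w2 : phase_space p ->
  decaying w -> decaying w1 -> decaying w2 ->
  skew p w (fadd w1 w2) = skew p w w1 + skew p w w2.
Proof.
  intros. rewrite skew_antisym, skew_fadd_l, (skew_antisym p w w1),
    (skew_antisym p w w2); trivial; ring.
Qed.

Lemma skew_fscal_r p c w w' : phase_space p -> decaying w -> decaying w' ->
  skew p w (fscal c w') = c * skew p w w'.
Proof.
  intros. rewrite skew_antisym, skew_fscal_l, (skew_antisym p w w'); trivial; ring.
Qed.

Lemma skew_potential p w : skew p w (swap p) = sumZ (s_ p w).
Proof. apply sumZ_ext; intros k; unfold s_, swap, Cdiv; simpl; ring. Qed.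

Lemma vanish_flip_P a : vanish (zflip a) -> vanish (zflip (fun k => a (k - 1)%Z)).
Proof.
  intros H; apply is_lim_seq_incr_1 in H; revert H; apply is_lim_seq_ext.
  intros n; unfold zflip; do 2 f_equal; lia.
Qed.

Lemma sumZ_eq_telescope a b c : summable a -> summable b ->
  (forall k, a k - b k = c (k + 1)%Z - c k) ->
  vanish c -> vanish (zflip c) -> sumZ a = sumZ b.
Proof.
  intros Ha Hb E V V'.
  assert (E0 : sumZ (fun k => a k + - b k) = 0) by now apply (@sumZ_telescope _ c).
  rewrite sumZ_plus, sumZ_opp in E0; trivial; [|now apply summable_opp].
  replace (sumZ a) with (sumZ a + - sumZ b + sumZ b) by ring. rewrite E0; ring.
Qed.

(** The two summands differ by the increment of
    [q_k u_(k-1) + r_(k-1) v_k]. *)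
Lemma skew_L_potential p w : phase_space p -> decaying w ->
  skew p w (L p (swap p)) = sumZ (m_ p w).
Proof.
  intros Hp Hw. pose proof (summable_m Hp Hw) as Hm.
  assert (HX : decaying (L p (swap p))) by (apply decaying_L, decaying_swap, Hp; trivial).
  pose proof (summable_skew Hp Hw HX) as Hsk.
  assert (Hd : forall k, dens p k <> 0) by apply Hp.
  rewrite L_potential in * by trivial. cbn [fst snd] in *.
  set (b := fun k => fst (p k) * fst (w (k - 1)%Z) + snd (p (k - 1)%Z) * snd (w k)).
  assert (Hb : summable b).
  { destruct Hp as [[Hq Hr] _], Hw as [Hu Hv].
    exact (summable_plus (summable_mult Hq (summable_P Hu))
                         (summable_mult (summable_P Hr) Hv)). }
  apply sumZ_eq_telescope with b; trivial.
  - intros k; unfold b, m_; cbn [fst snd]. replace (k + 1 - 1)%Z with k by lia.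
    field; apply Hd.
  - now apply summable_vanish.
  - now apply summable_vanish, summable_flip.
Qed.

(** [L] is self-adjoint for [skew] up to a correction of rank two.  Moving
    [L] across by summation by parts turns the sums over [j >= k] into
    opposites of sums over [j <= k]; these differ from the former by full
    sums over [Z], which are pairings with [X = swap p] and with [L p X] and
    multiply [L p X] and [X]. *)
Lemma skew_L p w w' : phase_space p -> decaying w -> decaying w' ->
  skew p (L p w) w' = skew p w (L p w')
    + skew p w' (swap p) * skew p w (L p (swap p))
    + skew p w' (L p (swap p)) * skew p w (swap p).
Proof.
  intros Hp Hw Hw'.
  assert (HX : decaying (swap p)) by apply decaying_swap, Hp.
  assert (HLX : decaying (L p (swap p))) by now apply decaying_L.
  pose proof (decaying_L Hp Hw) as HLw. pose proof (decaying_L Hp Hw') as HLw'.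
  pose proof (summable_s Hp Hw) as Hs. pose proof (summable_m Hp Hw) as Hm.
  pose proof (summable_s Hp Hw') as Hs'. pose proof (summable_m Hp Hw') as Hm'.
  rewrite (skew_potential p w'), (skew_L_potential Hp Hw').
  set (a := sumZ (s_ p w')). set (b := sumZ (m_ p w')).
  rewrite <- !skew_fscal_r, <- !skew_fadd_r; auto using decaying_fadd, decaying_fscal.
  (* [W] is the exact adjoint of [L] applied to [w']. *)
  set (W := fadd (fadd _ _) _).
  assert (HW : decaying W) by (unfold W; auto using decaying_fadd, decaying_fscal).
  assert (EW : forall k, W k =
    ( fst (w' (k - 1)%Z) + dens p k * snd (p (k - 1)%Z) * sum_le (s_ p w') (k - 1)
        + snd (p k) * sum_le (m_ p w') (k - 1),
      snd (w' (k + 1)%Z) + dens p k * fst (p (k + 1)%Z) * sum_le (s_ p w') k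
        + fst (p k) * sum_le (m_ p w') k )).
  { intros k; unfold W; rewrite L_potential by trivial. unfold fadd, fscal, L, swap.
    cbn [fst snd].
    change (fun j => fst (p j) * fst (w' (j - 1)%Z) - snd (p j) * snd (w' (j + 1)%Z))
      with (m_ p w').
    pose proof (@sumZ_split _ k Hs') as A1. pose proof (@sumZ_split _ (k - 1) Hs') as A2.
    pose proof (@sumZ_split _ k Hm') as B1. pose proof (@sumZ_split _ (k - 1) Hm') as B2.
    replace (k - 1 + 1)%Z with k in * by lia. fold a in A1, A2. fold b in B1, B2.
    f_equal; [rewrite A2, B2 | rewrite A1, B1]; ring. }
  assert (HS' : forall k, sum_le (s_ p w') k = s_ p w' k + sum_le (s_ p w') (k - 1))
    by (intros; now apply sum_le_rec).
  assert (HM' : forall k, sum_le (m_ p w') k = m_ p w' k + sum_le (m_ p w') (k - 1))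
    by (intros; now apply sum_le_rec).
  assert (HS : forall k, sum_ge (s_ p w) k = s_ p w k + sum_ge (s_ p w) (k + 1))
    by (intros; now apply sum_ge_rec).
  assert (HM : forall k, sum_ge (m_ p w) k = m_ p w k + sum_ge (m_ p w) (k + 1))
    by (intros; now apply sum_ge_rec).
  pose proof (summable_skew Hp HLw Hw') as SA. pose proof (summable_skew Hp Hw HW) as SB.
  set (x := fun k => fst (p k) * fst (w (k - 1)%Z) + snd (p (k - 1)%Z) * snd (w k)).
  set (y := fun k => fst (p k) * fst (w' (k - 1)%Z) + snd (p (k - 1)%Z) * snd (w' k)).
  set (z := fun k => fst (w (k - 1)%Z) * snd (w' k) + snd (w k) * fst (w' (k - 1)%Z)).
  set (S := sum_ge (s_ p w)) in *. set (M := sum_ge (m_ p w)) in *.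
  set (S' := sum_le (s_ p w')) in *. set (M' := sum_le (m_ p w')) in *.
  set (S1 := fun k => S' (k - 1)%Z). set (M1 := fun k => M' (k - 1)%Z).
  assert (VS : vanish S) by now apply vanish_sum_ge.
  assert (VM : vanish M) by now apply vanish_sum_ge.
  assert (VS1 : vanish (zflip S1)) by now apply vanish_flip_P, vanish_flip_sum_le.
  assert (VM1 : vanish (zflip M1)) by now apply vanish_flip_P, vanish_flip_sum_le.
  assert (BS : seq_bounded S) by now apply bounded_sum_ge.
  assert (BM : seq_bounded M) by now apply bounded_sum_ge.
  assert (BS1 : seq_bounded S1) by now apply (@bounded_shift S' (-1)), bounded_sum_le.
  assert (BM1 : seq_bounded M1) by now apply (@bounded_shift M' (-1)), bounded_sum_le.
  assert (Hxyz : summable x /\ summable y /\ summable z).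
  { destruct Hp as [[Hq Hr] _], Hw as [Hu Hv], Hw' as [Hu' Hv'].
    split; [|split].
    - exact (summable_plus (summable_mult Hq (summable_P Hu))
                           (summable_mult (summable_P Hr) Hv)).
    - exact (summable_plus (summable_mult Hq (summable_P Hu'))
                           (summable_mult (summable_P Hr) Hv')).
    - exact (summable_plus (summable_mult (summable_P Hu) Hv')
                           (summable_mult Hv (summable_P Hu'))). }
  destruct Hxyz as [Hx [Hy Hz]].
  assert (Bx : seq_bounded x) by now apply bounded_summable.
  assert (By : seq_bounded y) by now apply bounded_summable.
  (* The boundary terms of all the summations by parts. *)
  apply sumZ_eq_telescope with
    (fun k => S k * M1 k + S k * y k + M k * S1 k - x k * S1 k - z k); trivial.
  - intros k. rewrite EW.
    change (L p w k) with
      ( fst (w (k - 1)%Z) - dens p k * snd (p (k - 1)%Z) * S k - snd (p k) * M k,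
        snd (w (k + 1)%Z) - dens p k * fst (p (k + 1)%Z) * S (k + 1)%Z
          - fst (p k) * M (k + 1)%Z ).
    unfold x, y, z, S1, M1; cbn [fst snd]. replace (k + 1 - 1)%Z with k by lia.
    rewrite (HS k), (HM k), (HS' k), (HM' k). unfold s_, m_.
    assert (Ed : dens p k <> 0) by apply Hp.
    unfold dens in *. field; trivial.
  - exact (vanish_minus (vanish_minus (vanish_plus (vanish_plus
      (vanish_mulr VS BM1) (vanish_mulr VS By)) (vanish_mulr VM BS1))
      (vanish_mulr (summable_vanish Hx) BS1)) (summable_vanish Hz)).
  - pose proof (fun a Ha => summable_vanish (@summable_flip a Ha)) as F.
    exact (vanish_minus (vanish_minus (vanish_plus (vanish_plus
      (vanish_mull (bounded_flip BS) VM1) (vanish_mull (bounded_flip BS) (F _ Hy)))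
      (vanish_mull (bounded_flip BM) VS1))
      (vanish_mull (bounded_flip Bx) VS1)) (F _ Hz)).
Qed.

(** * Isotropic vectors *)

(** The vectors [L^a X], [a] in [Z], with [X = swap p]: one of the two
    exponents below is zero. *)
Definition orbit (p : field) (a : Z) : field :=
  Nat.iter (Z.to_nat (- a)) (Linv p) (Nat.iter (Z.to_nat a) (L p) (swap p)).

Lemma iter_decaying (A : field -> field) w n :
  (forall w, decaying w -> decaying (A w)) -> decaying w -> decaying (Nat.iter n A w).
Proof. intros HA Hw; induction n; simpl; auto. Qed.

Lemma decaying_orbit p a : phase_space p -> decaying (orbit p a).
Proof.
  intros Hp; apply iter_decaying; [intros; now apply decaying_Linv|].
  apply iter_decaying; [intros; now apply decaying_L|]. apply decaying_swap, Hp.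
Qed.

Lemma L_orbit p a : phase_space p -> L p (orbit p a) = orbit p (a + 1).
Proof.
  intros Hp. assert (HX : decaying (swap p)) by apply decaying_swap, Hp.
  unfold orbit. destruct (Z_le_gt_dec 0 a) as [H|H].
  - replace (Z.to_nat (- a)) with 0%nat by lia.
    replace (Z.to_nat (- (a + 1))) with 0%nat by lia.
    now replace (Z.to_nat (a + 1)) with (S (Z.to_nat a)) by lia.
  - replace (Z.to_nat a) with 0%nat by lia.
    replace (Z.to_nat (a + 1)) with 0%nat by lia.
    replace (Z.to_nat (- a)) with (S (Z.to_nat (- (a + 1)))) by lia. simpl.
    apply L_Linv; trivial. apply iter_decaying; trivial.
    intros; now apply decaying_Linv.
Qed.

Lemma eq_opp_0 (c : C) : c = - c -> c = 0.
Proof.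
  destruct c as [x y]; intros E; injection E as Ex Ey.
  unfold RtoC; f_equal; lra.
Qed.

Lemma skew_self p w : skew p w w = 0.
Proof. apply eq_opp_0, skew_antisym. Qed.

(** Write [x_n = L^n X].  If [skew x_j X = 0] for [j < n], the correction
    terms of [skew_L] all vanish while the [n] factors [L] are moved one by
    one from the left to the right of [skew x_n X].  Hence
    [skew x_n X = skew X x_n], and both sides are zero by antisymmetry. *)
Lemma skew_iter_L p n : phase_space p ->
  skew p (Nat.iter n (L p) (swap p)) (swap p) = 0.
Proof.
  intros Hp. set (x := fun n => Nat.iter n (L p) (swap p)).
  assert (Hx : forall n, decaying (x n)).
  { intros; apply iter_decaying; [intros; now apply decaying_L|].
    apply decaying_swap, Hp. }
  change (skew p (x n) (x 0%nat) = 0).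
  assert (E : forall m i, skew p (x (S m)) (x i) = skew p (x m) (x (S i))
    + skew p (x i) (x 0%nat) * skew p (x m) (x 1%nat)
    + skew p (x i) (x 1%nat) * skew p (x m) (x 0%nat))
    by (intros; now apply skew_L).
  assert (E1 : skew p (x 0%nat) (x 1%nat) = 0).
  { pose proof (E 0%nat 0%nat) as E0. rewrite (skew_self p (x 0%nat)) in E0.
    apply eq_opp_0. rewrite (skew_antisym p (x 0%nat) (x 1%nat)) at 2.
    rewrite E0; ring. }
  assert (G : forall m, skew p (x m) (x 1%nat) = skew p (x (S m)) (x 0%nat)).
  { intros m; rewrite E, E1, skew_self; ring. }
  induction n as [n IH] using lt_wf_ind.
  assert (F : forall m i, (m + i = n)%nat -> skew p (x m) (x i) = skew p (x 0%nat) (x n)).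
  { induction m as [|m IHm]; intros i Hi; [now subst|].
    rewrite E, IHm, !G by lia.
    (* The indices of the two factors add up to [n]: one of them is 0, or else
       both are less than [n]. *)
    assert (Z1 : skew p (x i) (x 0%nat) * skew p (x (S m)) (x 0%nat) = 0).
    { destruct i; [rewrite skew_self | rewrite (IH (S m)) by lia]; ring. }
    assert (Z2 : skew p (x (S i)) (x 0%nat) * skew p (x m) (x 0%nat) = 0).
    { destruct m; [rewrite skew_self | rewrite (IH (S i)) by lia]; ring. }
    rewrite Z1, Z2; ring. }
  apply eq_opp_0. rewrite <- skew_antisym. apply F; lia.
Qed.

Lemma skew_swap p w w' : skew (swap p) (swap w) (swap w') = - skew p w w'.
Proof.
  unfold skew; rewrite <- sumZ_opp; apply sumZ_ext; intros k.
  rewrite dens_swap; unfold swap, Cdiv; simpl; ring.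
Qed.

Lemma iter_Linv_swap p w n :
  Nat.iter n (Linv p) w = swap (Nat.iter n (L (swap p)) (swap w)).
Proof.
  induction n; simpl; [now rewrite swap_swap|].
  now rewrite Linv_swap, IHn, swap_swap.
Qed.

Lemma skew_orbit p a : phase_space p -> skew p (orbit p a) (swap p) = 0.
Proof.
  intros Hp; unfold orbit. destruct (Z_le_gt_dec 0 a) as [H|H].
  - replace (Z.to_nat (- a)) with 0%nat by lia. now apply skew_iter_L.
  - replace (Z.to_nat a) with 0%nat by lia. cbn [Nat.iter nat_rect].
    set (n := Z.to_nat (- a)).
    pose proof (skew_swap (swap p) (Nat.iter n (L (swap p)) (swap (swap p)))
                          (swap (swap p))) as E.
    rewrite (skew_iter_L n (phase_space_swap Hp)), <- iter_Linv_swap in E.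
    rewrite !swap_swap in E. rewrite E; ring.
Qed.

Lemma skew_orbit_L p a : phase_space p ->
  skew p (orbit p a) (L p (swap p)) = 0.
Proof.
  intros Hp.
  assert (HX : decaying (swap p)) by apply decaying_swap, Hp.
  pose proof (skew_L Hp (decaying_orbit a Hp) HX) as A.
  rewrite (L_orbit _ Hp), !(skew_orbit _ Hp), skew_self in A.
  ring_simplify in A. now symmetry.
Qed.

(** Orthogonality to the whole orbit, and not only to [X] and [L^(+-1) X],
    is what [L] and [Linv] preserve. *)
Definition isotropic (p w : field) : Prop :=
  decaying w /\ forall a, skew p w (orbit p a) = 0.

Lemma isotropic_fadd p w w' : phase_space p ->
  isotropic p w -> isotropic p w' -> isotropic p (fadd w w').
Proof.
  intros Hp [H E] [H' E']; split; [now apply decaying_fadd|]; intros a.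
  rewrite skew_fadd_l, E, E' by auto using decaying_orbit. ring.
Qed.

Lemma isotropic_fscal p c w : phase_space p ->
  isotropic p w -> isotropic p (fscal c w).
Proof.
  intros Hp [H E]; split; [now apply decaying_fscal|]; intros a.
  rewrite skew_fscal_l, E by auto using decaying_orbit. ring.
Qed.

(** The correction terms of [skew_L] contain pairings of two elements of the
    orbit. *)
Lemma isotropic_L p w : phase_space p -> isotropic p w -> isotropic p (L p w).
Proof.
  intros Hp [H E]; split; [now apply decaying_L|]; intros a.
  rewrite skew_L, (skew_orbit a Hp), (skew_orbit_L a Hp), (L_orbit a Hp), E
    by auto using decaying_orbit.
  ring.
Qed.

(** Apply [skew_L] to [Linv p w], with [L^(a-1) X] on the right. *)
Lemma isotropic_Linv p w : phase_space p -> isotropic p w -> isotropic p (Linv p w).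
Proof.
  intros Hp [H E]; split; [now apply decaying_Linv|]; intros a.
  pose proof (decaying_Linv Hp H) as H'.
  pose proof (skew_L Hp H' (decaying_orbit (a - 1) Hp)) as A.
  rewrite (L_Linv Hp H), E, (L_orbit _ Hp), (skew_orbit _ Hp) in A.
  rewrite (skew_orbit_L _ Hp) in A.
  replace (a - 1 + 1)%Z with a in A by lia.
  rewrite A; ring_simplify. ring_simplify in A. now symmetry.
Qed.

Lemma isotropic_potential p : phase_space p -> isotropic p (swap p).
Proof.
  intros Hp; split; [apply decaying_swap, Hp|]; intros a.
  rewrite skew_antisym, skew_orbit by trivial; ring.
Qed.

Lemma isotropic_Lplus p w : phase_space p -> isotropic p w -> isotropic p (Lplus p w).
Proof.
  intros Hp H; apply isotropic_fadd; auto using isotropic_L, isotropic_Linv.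
Qed.

Lemma skew_Linv_potential p w : phase_space p -> decaying w ->
  skew p w (Linv p (swap p)) = sumZ (n_ p w).
Proof.
  intros Hp Hw.
  pose proof (skew_swap p w (Linv p (swap p))) as E.
  rewrite (Linv_swap p (swap p)), swap_swap, skew_L_potential in E
    by auto using phase_space_swap, decaying_swap.
  rewrite Linv_swap.
  replace (skew p w _) with (- sumZ (m_ (swap p) (swap w))) by (rewrite E; ring).
  rewrite <- sumZ_opp; apply sumZ_ext; intros k; rewrite m_swap; ring.
Qed.

(** [Lplus] and [Lminus] differ by replacing sums to [+oo] with opposites of
    sums to [-oo], that is by the full sums of [s_] and of [t_ = n_ - m_].
    These are the pairings of [w] with [X], [L X] and [Linv X]. *)
Lemma Lminus_isotropic p w : phase_space p -> isotropic p w ->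
  Lminus p w = Lplus p w.
Proof.
  intros Hp [Hw E].
  pose proof (summable_s Hp Hw) as Hs. pose proof (summable_m Hp Hw) as Hm.
  pose proof (summable_n Hp Hw) as Hn.
  assert (S0 : sumZ (s_ p w) = 0) by (rewrite <- skew_potential; apply (E 0%Z)).
  assert (M0 : sumZ (m_ p w) = 0).
  { rewrite <- skew_L_potential by trivial. apply (E 1%Z). }
  assert (N0 : sumZ (n_ p w) = 0).
  { rewrite <- skew_Linv_potential by trivial. apply (E (-1)%Z). }
  assert (Et : forall k, n_ p w k + - m_ p w k = t_ p w k)
    by (intros k; unfold n_, m_, t_; ring).
  assert (Ht : summable (t_ p w))
    by exact (summable_ext _ Et (summable_plus Hn (summable_opp Hm))).
  assert (T0 : sumZ (t_ p w) = 0).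
  { rewrite <- (sumZ_ext _ _ Et), (sumZ_plus Hn (summable_opp Hm)), sumZ_opp, M0, N0.
    ring. }
  assert (ES : forall k, sum_le (s_ p w) k = - sum_ge (s_ p w) (k + 1)).
  { intros k; pose proof (sumZ_split k Hs) as A; rewrite S0 in A.
    replace (sum_le (s_ p w) k) with (0 - sum_ge (s_ p w) (k + 1))
      by (rewrite A; ring). ring. }
  assert (ET : forall k, sum_le (t_ p w) k
                         = sum_ge (m_ p w) (k + 1) - sum_ge (n_ p w) (k + 1)).
  { intros k; pose proof (sumZ_split k Ht) as A; rewrite T0 in A.
    rewrite <- (sum_ge_ext _ _ _ Et), (sum_ge_plus _ Hn (summable_opp Hm)) in A.
    replace (sum_ge (fun j => - m_ p w j) (k + 1)) with (- sum_ge (m_ p w) (k + 1)) in A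
      by (symmetry; apply CSeries_opp).
    replace (sum_le (t_ p w) k)
      with (0 - (sum_ge (n_ p w) (k + 1) + - sum_ge (m_ p w) (k + 1)))
      by (rewrite A; ring). ring. }
  apply field_ext; intros k; unfold Lminus, Lplus, fadd, L, Linv; cbn [fst snd];
  fold (m_ p w); fold (n_ p w);
  rewrite !ES, ET; replace (k - 1 + 1)%Z with k by lia.
  - rewrite (sum_ge_rec k Hm). unfold m_ at 2. ring.
  - rewrite (sum_ge_rec k Hn). unfold n_ at 2. ring.
Qed.

(** * The logarithm near 1 *)

(** [C_derive] is defined by a limit along the horizontal line through the
    point, so that the derivative of a real curve determines it. *)
Lemma C_derive_along_R (f : C -> C) (z : C) (g : R -> C) (l : C) :
  (forall h : R, f (z + h) - f z = g h - g 0%R) ->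
  is_derive (fun h => Re (g h)) 0%R (Re l) ->
  is_derive (fun h => Im (g h)) 0%R (Im l) ->
  C_derive f z = l.
Proof.
  intros E D1 D2.
  assert (K : forall (e : R -> R) (F : R -> R) (m : R), is_derive e 0%R m ->
    (forall h, h <> 0%R -> F (fst z + h)%R = ((e h - e 0) / h)%R) ->
    Lim F (fst z) = m).
  { intros e F m D HF. apply is_lim_unique, is_lim_spec; intros eps.
    apply is_derive_Reals in D.
    destruct (D eps (cond_pos eps)) as [delta Hd].
    exists delta; intros x Hx Hne.
    assert (Hx0 : (x - fst z)%R <> 0%R) by lra.
    specialize (Hd (x - fst z)%R Hx0 Hx). rewrite Rplus_0_l in Hd.
    replace x with (fst z + (x - fst z))%R by ring.
    rewrite HF by trivial. exact Hd. }
  assert (Q : forall h : R, h <> 0%R ->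
    (f ((fst z + h)%R, snd z) - f z) / (((fst z + h)%R, snd z) - z)
    = (g h - g 0%R) * RtoC (/ h)).
  { intros h Hh. replace ((fst z + h)%R, snd z) with (z + h).
    - rewrite E. replace (z + h - z) with (RtoC h) by ring.
      unfold Cdiv. now rewrite RtoC_inv.
    - destruct z; unfold Cplus, RtoC; simpl; f_equal; ring. }
  unfold C_derive, C_lim. destruct l as [l1 l2]. f_equal.
  - rewrite (K _ _ _ D1); trivial. intros h Hh; rewrite Q by trivial.
    unfold Cminus, Cplus, Copp, Cmult, RtoC, Re, Im; simpl; field; trivial.
  - rewrite (K _ _ _ D2); trivial. intros h Hh; rewrite Q by trivial.
    unfold Cminus, Cplus, Copp, Cmult, RtoC, Re, Im; simpl; field; trivial.
Qed.

Lemma Clog_1 : Clog 1 = 0.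
Proof.
  unfold Clog, Carg. rewrite Cmod_1, ln_1. simpl.
  destruct (Rlt_dec 0 (1 + 1)); [|lra].
  unfold Rdiv; rewrite Rmult_0_l, atan_0, Rmult_0_r. reflexivity.
Qed.

Ltac sqrt_at_0 := repeat match goal with |- context [sqrt ?a] =>
  progress replace (sqrt a) with 1%R
    by (transitivity (sqrt 1); [now rewrite sqrt_1 | f_equal; ring]) end.

Lemma ln_Cmod_derive (b : C) :
  is_derive (fun h : R => ln (Cmod (1 + h * b))) 0%R (Re b).
Proof.
  destruct b as [x y].
  apply is_derive_ext with (fun h =>
    ln (sqrt ((1 + h * x) * (1 + h * x) + (h * y) * (h * y))%R)).
  { intros h; unfold Cmod; simpl; do 2 f_equal; ring. }
  auto_derive.
  - sqrt_at_0; repeat split; rewrite ?Rmult_0_l; lra.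
  - sqrt_at_0. unfold Re; simpl; field.
Qed.

Lemma Carg_derive (b : C) :
  is_derive (fun h : R => Carg (1 + h * b)) 0%R (Im b).
Proof.
  destruct b as [x y].
  apply is_derive_ext_loc with (fun h => 2 * atan (h * y /
    (sqrt ((1 + h * x) * (1 + h * x) + (h * y) * (h * y)) + (1 + h * x))))%R.
  { assert (Hp : (0 < / (1 + Rabs x))%R)
      by (apply Rinv_0_lt_compat; generalize (Rabs_pos x); lra).
    exists (mkposreal _ Hp); intros h Hh. change (Rabs (h - 0) < / (1 + Rabs x))%R in Hh.
    rewrite Rminus_0_r in Hh.
    assert (B : (Rabs (h * x) < 1)%R).
    { rewrite Rabs_mult. generalize (Rabs_pos x) (Rabs_pos h); intros P1 P2.
      apply Rmult_lt_compat_r with (r := (1 + Rabs x)%R) in Hh; [|lra].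
      rewrite Rinv_l in Hh by lra. nra. }
    apply Rabs_def2 in B.
    assert (Ec : Cmod (1 + h * (x, y))
                 = sqrt ((1 + h * x) * (1 + h * x) + (h * y) * (h * y))).
    { unfold Cmod; simpl; f_equal; ring. }
    assert (Er : Re (1 + h * (x, y)) = (1 + h * x)%R) by (simpl; ring).
    assert (Ei : Im (1 + h * (x, y)) = (h * y)%R) by (simpl; ring).
    unfold Carg. rewrite Ec, Er, Ei.
    destruct (Rlt_dec _ _) as [|N]; trivial.
    exfalso; apply N.
    generalize (sqrt_pos ((1 + h * x) * (1 + h * x) + (h * y) * (h * y))); lra. }
  auto_derive.
  - sqrt_at_0; repeat split; rewrite ?Rmult_0_l; lra.
  - sqrt_at_0. unfold Im; simpl; field.
Qed.

(** An estimate without smallness assumption, so that the summability of the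
    logarithms needs no discussion of the first terms. *)
Lemma Clog_bound (M : R) (z : C) : z <> 0 -> (Cmod (/ z) <= M)%R ->
  (Cmod (Clog z) <= (1 + M + 2 * PI + 2) * Cmod (z - 1))%R.
Proof.
  intros Hz HM. set (e := Cmod (z - 1)). assert (He : (0 <= e)%R) by apply Cmod_ge_0.
  assert (HPI := PI_RGT_0).
  assert (P : (0 < Cmod z)%R) by now apply Cmod_gt_0.
  assert (HMz : (/ Cmod z <= M)%R) by now rewrite <- Cmod_inv.
  assert (PM : (0 < M)%R) by (generalize (Rinv_0_lt_compat _ P); lra).
  assert (T : (Rabs (Cmod z - 1) <= e)%R).
  { apply Rabs_le. unfold e.
    pose proof (Cmod_triangle (z - 1) 1) as A1.
    pose proof (Cmod_triangle z (-(z - 1))) as A2. rewrite Cmod_opp in A2.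
    replace (z - 1 + 1) with z in A1 by ring.
    replace (z + - (z - 1)) with (RtoC 1) in A2 by ring.
    rewrite Cmod_1 in *. lra. }
  assert (ln_le : forall x, (0 < x)%R -> (ln x <= x - 1)%R).
  { intros x Hx. pose proof (exp_ineq1_le (ln x)) as A. rewrite exp_ln in A; lra. }
  assert (B1 : (Rabs (ln (Cmod z)) <= (1 + M) * e)%R).
  { apply Rabs_le; split.
    - pose proof (ln_le (/ Cmod z)%R (Rinv_0_lt_compat _ P)) as A.
      rewrite ln_Rinv in A by trivial.
      assert (A2 : (/ Cmod z - 1 <= M * e)%R).
      { replace (/ Cmod z - 1)%R with (/ Cmod z * (1 - Cmod z))%R by (field; lra).
        apply Rabs_le_between in T.
        apply Rle_trans with (/ Cmod z * e)%R.
        - apply Rmult_le_compat_l; [|lra]. apply Rlt_le, Rinv_0_lt_compat, P.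
        - now apply Rmult_le_compat_r. }
      nra.
    - pose proof (ln_le _ P). apply Rabs_le_between in T. nra. }
  assert (Bi : (Rabs (Im z) <= e)%R).
  { replace (Im z) with (Im (z - 1)) by (unfold Im; simpl; ring). apply Im_le_Cmod. }
  assert (Br : (Rabs (1 - Re z) <= e)%R).
  { rewrite <- Rabs_Ropp.
    replace (- (1 - Re z))%R with (Re (z - 1)) by (unfold Re; simpl; ring).
    apply Re_le_Cmod. }
  assert (B2 : (Rabs (Carg z) <= (2 * PI + 2) * e)%R).
  { destruct (Rle_lt_dec (Re z) (1 / 2)) as [H|H].
    - assert (C1 : (Rabs (Carg z) <= PI)%R).
      { unfold Carg; destruct (Rlt_dec _ _).
        - destruct (atan_bound (Im z / (Cmod z + Re z))). apply Rabs_le; lra.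
        - rewrite Rabs_pos_eq; lra. }
      apply Rabs_le_between in Br. nra.
    - pose proof (Re_le_Cmod z) as A. apply Rabs_le_between in A.
      unfold Carg; destruct (Rlt_dec _ _); [|lra].
      assert (at_le : forall y, (Rabs (atan y) <= Rabs y)%R).
      { intros y.
        destruct (MVT_gen atan 0 y (fun c => / (1 + c ^ 2))%R) as [c [_ Ec]].
        - intros c _. auto_derive; trivial.
          unfold Rdiv, Rsqr; rewrite Rmult_1_l; f_equal; ring.
        - intros c _. apply derivable_continuous_pt, derivable_pt_atan.
        - rewrite atan_0, !Rminus_0_r in Ec. rewrite Ec, Rabs_mult.
          assert (Q : (1 <= 1 + c ^ 2)%R) by nra.
          rewrite (Rabs_pos_eq (/ _)) by (apply Rlt_le, Rinv_0_lt_compat; lra).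
          apply Rle_trans with (1 * Rabs y)%R; [|lra].
          apply Rmult_le_compat_r; [apply Rabs_pos|].
          apply Rle_trans with (/ 1)%R; [apply Rinv_le_contravar; lra|lra]. }
      rewrite Rabs_mult, (Rabs_pos_eq 2) by lra.
      pose proof (at_le (Im z / (Cmod z + Re z))%R) as A3.
      assert (A4 : (Rabs (Im z / (Cmod z + Re z)) <= e)%R).
      { unfold Rdiv; rewrite Rabs_mult, (Rabs_pos_eq (/ _))
          by (apply Rlt_le, Rinv_0_lt_compat; lra).
        apply Rle_trans with (e * 1)%R; [|lra].
        apply Rmult_le_compat; trivial using Rabs_pos.
        - apply Rlt_le, Rinv_0_lt_compat; lra.
        - apply Rle_trans with (/ 1)%R; [apply Rinv_le_contravar; lra|lra]. }
      nra. }
  eapply Rle_trans; [apply Cmod_parts|]. simpl. lra.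
Qed.

(** * The gradient of [H0] *)

Lemma summable_Clog_dens p : phase_space p -> summable (fun k => Clog (dens p k)).
Proof.
  intros Hp. destruct (bounded_inv_dens Hp) as [M HM].
  destruct Hp as [[Hq Hr] Hd].
  apply (@summable_le (fun k => snd (p k) * fst (p k)) _ (1 + M + 2 * PI + 2)%R);
    [|now apply summable_mult].
  intros k. eapply Rle_trans; [apply Clog_bound; [apply Hd | apply HM]|].
  unfold dens. replace (1 - snd (p k) * fst (p k) - 1)
    with (- (snd (p k) * fst (p k))) by ring.
  rewrite Cmod_opp; lra.
Qed.

(** A change at one site changes one term of the sum. *)
Lemma H0_local p p' k : phase_space p ->
  (forall j, j <> k -> dens p' j = dens p j) ->
  H0 p p' = - sumZ (fun j => Clog (dens p j)) - Clog (dens p' k / dens p k).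
Proof.
  intros Hp E. destruct (sumZ_single k (Clog (dens p' k / dens p k))) as [Hs Es].
  enough (A : sumZ (fun j => Clog_near (dens p j) (dens p' j))
              = sumZ (fun j => Clog (dens p j)) + Clog (dens p' k / dens p k))
    by (unfold H0; rewrite A; ring).
  rewrite <- Es at 1. rewrite <- sumZ_plus; auto using summable_Clog_dens.
  apply sumZ_ext; intros j; unfold Clog_near. destruct (Z.eq_dec j k) as [->|N].
  - ring.
  - rewrite E by trivial. replace (dens p j / dens p j) with (RtoC 1)
      by (field; apply Hp). rewrite Clog_1; ring.
Qed.

(** A variable moved at site [k] enters the density there affinely; [b] is the
    relative slope. *)
Lemma H0_derive_along p (f : C -> field) z k b : phase_space p ->
  (forall x j, j <> k -> dens (f x) j = dens p j) ->
  (forall h : R, dens (f (z + h)) k / dens p k = 1 + h * b) ->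
  C_derive (fun x => H0 p (f x)) z = - b.
Proof.
  intros Hp E1 E2. apply C_derive_along_R with (fun h => - Clog (1 + h * b)).
  - intros h. pose proof (E2 0%R) as E0.
    replace (z + 0%R) with z in E0 by ring.
    rewrite !(@H0_local p _ k) by auto. rewrite E2, E0. ring.
  - apply (is_derive_opp (fun h : R => ln (Cmod (1 + h * b)))), ln_Cmod_derive.
  - apply (is_derive_opp (fun h : R => Carg (1 + h * b))), Carg_derive.
Qed.

Lemma nabla_H0 p : phase_space p -> nabla (H0 p) p = fscal (- (1)) p.
Proof.
  intros Hp. assert (Hd : forall k, dens p k <> 0) by apply Hp.
  apply field_ext; intros k; unfold nabla, fscal; cbn [fst snd].
  - unfold delta_r.
    rewrite (@H0_derive_along p _ _ k (- fst (p k) / dens p k)); trivial.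
    + field; trivial.
    + intros x j N; unfold dens, upd_r; destruct (Z.eq_dec j k); [contradiction|trivial].
    + intros h. specialize (Hd k). unfold upd_r, dens at 1.
      destruct (Z.eq_dec k k); [|contradiction]. cbn [fst snd].
      unfold dens in *. field; trivial.
  - unfold delta_q.
    rewrite (@H0_derive_along p _ _ k (- snd (p k) / dens p k)); trivial.
    + field; trivial.
    + intros x j N; unfold dens, upd_q; destruct (Z.eq_dec j k); [contradiction|trivial].
    + intros h. specialize (Hd k). unfold upd_q, dens at 1.
      destruct (Z.eq_dec k k); [|contradiction]. cbn [fst snd].
      unfold dens in *. field; trivial.
Qed.

(** * Polynomials in [Lplus] and Laurent polynomials in [L] *)

Lemma fadd_comm w w' : fadd w w' = fadd w' w.
Proof. apply field_ext; intros k; unfold fadd; simpl; ring. Qed.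

(** Linearity is required on decaying vectors only, where the sums that
    define the operators converge. *)
Definition linear_op (A : field -> field) : Prop :=
  (forall w, decaying w -> decaying (A w)) /\
  (forall w w', decaying w -> decaying w' -> A (fadd w w') = fadd (A w) (A w')) /\
  (forall c w, decaying w -> A (fscal c w) = fscal c (A w)).

Lemma linear_L p : phase_space p -> linear_op (L p).
Proof.
  intros Hp; split; [|split]; intros;
  [now apply decaying_L | now apply L_fadd | now apply L_fscal].
Qed.

Lemma linear_Linv p : phase_space p -> linear_op (Linv p).
Proof.
  intros Hp; split; [|split]; intros;
  [now apply decaying_Linv | now apply Linv_fadd | now apply Linv_fscal].
Qed.

Lemma decaying_op_poly P A w : linear_op A -> decaying w -> decaying (op_poly P A w).
Proof.
  intros HA; revert w; induction P as [|c P IH]; intros w Hw; simpl.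
  - split; apply summable_ext with (fun k => 0 * fst (w k)); try (intros; simpl; ring);
    apply summable_scal, Hw.
  - apply decaying_fadd; [now apply decaying_fscal | now apply IH, HA].
Qed.

Lemma op_poly_comm P A w : linear_op A -> decaying w ->
  A (op_poly P A w) = op_poly P A (A w).
Proof.
  intros HA; revert w; induction P as [|c P IH]; intros w Hw; simpl.
  - assert (E : forall v, (fun _ : Z => (RtoC 0, RtoC 0)) = fscal 0 v)
      by (intros v; apply field_ext; intros k; simpl; ring).
    rewrite (E w), (proj2 (proj2 HA)), <- (E (A w)); trivial.
  - pose proof (proj1 HA _ Hw) as HAw.
    rewrite (proj1 (proj2 HA)), (proj2 (proj2 HA)), IH;
    auto using decaying_fscal, decaying_op_poly.
Qed.

Fixpoint poly_add (P Q : list C) : list C :=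
  match P, Q with
  | nil, _ => Q
  | _, nil => P
  | a :: P', b :: Q' => (a + b) :: poly_add P' Q'
  end.

Lemma op_poly_add P Q A w :
  op_poly (poly_add P Q) A w = fadd (op_poly P A w) (op_poly Q A w).
Proof.
  revert Q w; induction P as [|a P IH]; intros [|b Q] w; simpl; rewrite ?IH;
  apply field_ext; intros k; unfold fadd, fscal; simpl; ring.
Qed.

Lemma op_poly_scal c P A w :
  op_poly (map (Cmult c) P) A w = fscal c (op_poly P A w).
Proof.
  revert w; induction P as [|a P IH]; intros w; simpl; rewrite ?IH;
  apply field_ext; intros k; unfold fadd, fscal; simpl; ring.
Qed.

Lemma op_poly_monomial n c A w :
  op_poly (repeat (RtoC 0) n ++ c :: nil) A w = fscal c (Nat.iter n A w).
Proof.
  revert w; induction n as [|n IH]; intros w.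
  - apply field_ext; intros k; simpl; ring.
  - cbn [repeat app op_poly]; rewrite IH, Nat.iter_succ_r.
    apply field_ext; intros k; simpl; ring.
Qed.

Definition laurent (A B : field -> field) (w1 w2 : list C) (x : field) : field :=
  fadd (op_poly w1 A x) (op_poly w2 B x).

(** Multiplication of a Laurent polynomial by its variable moves the constant
    term of the second part, which holds the powers of the inverse, to the
    linear term of the first part. *)
Lemma laurent_shift (w1 w2 : list C) : exists w1' w2' : list C,
  forall A B x, linear_op A -> linear_op B -> decaying x ->
  (forall w, decaying w -> A (B w) = w) ->
  A (laurent A B w1 w2 x) = laurent A B w1' w2' x.
Proof.
  destruct w2 as [|c w2].
  - exists (RtoC 0 :: w1), nil. intros A B x HA HB Hx AB. unfold laurent.
    rewrite (proj1 (proj2 HA)), op_poly_comm by auto using decaying_op_poly.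
    change (op_poly nil B x) with (op_poly nil A x).
    rewrite op_poly_comm by trivial. apply field_ext; intros k; simpl; ring.
  - exists (poly_add (RtoC 0 :: c :: nil) (RtoC 0 :: w1)), w2.
    intros A B x HA HB Hx AB. unfold laurent.
    pose proof (proj1 HA _ Hx). pose proof (proj1 HB _ Hx).
    rewrite op_poly_add. cbn [op_poly].
    rewrite !(proj1 (proj2 HA)), (proj2 (proj2 HA)), (op_poly_comm w1 HA Hx),
      <- (op_poly_comm w2 HB Hx), AB
      by auto using decaying_op_poly, decaying_fscal, decaying_fadd.
    apply field_ext; intros k; simpl; ring.
Qed.

(** Both [L] and [Linv] shift Laurent polynomials in [L], and the coefficients
    of the result do not depend on the potential. *)
Lemma laurent_Lplus w1 w2 : exists w1' w2', forall p, phase_space p ->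
  Lplus p (laurent (L p) (Linv p) w1 w2 (swap p))
  = laurent (L p) (Linv p) w1' w2' (swap p).
Proof.
  destruct (laurent_shift w1 w2) as [a1 [a2 Ha]].
  destruct (laurent_shift w2 w1) as [b2 [b1 Hb]].
  exists (poly_add a1 b1), (poly_add a2 b2). intros p Hp.
  assert (Hx : decaying (swap p)) by apply decaying_swap, Hp.
  specialize (Ha (L p) (Linv p) (swap p) (linear_L Hp) (linear_Linv Hp) Hx
                (fun w => L_Linv Hp (w := w))).
  specialize (Hb (Linv p) (L p) (swap p) (linear_Linv Hp) (linear_L Hp) Hx
                (fun w => Linv_L Hp (w := w))).
  unfold Lplus. rewrite Ha. unfold laurent in *.
  rewrite (fadd_comm (op_poly w1 (L p) (swap p))), Hb, !op_poly_add.
  apply field_ext; intros k; simpl; ring.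
Qed.

Lemma laurent_op_poly_Lplus P : forall w1 w2, exists w1' w2',
  forall p, phase_space p ->
  op_poly P (Lplus p) (laurent (L p) (Linv p) w1 w2 (swap p))
  = laurent (L p) (Linv p) w1' w2' (swap p).
Proof.
  induction P as [|c P IH]; intros w1 w2.
  - exists nil, nil. intros p Hp. apply field_ext; intros k; simpl; ring.
  - destruct (laurent_Lplus w1 w2) as [a1 [a2 Ha]].
    destruct (IH a1 a2) as [b1 [b2 Hb]].
    exists (poly_add (map (Cmult c) w1) b1), (poly_add (map (Cmult c) w2) b2).
    intros p Hp. cbn [op_poly]. rewrite Ha, Hb by trivial. unfold laurent.
    rewrite !op_poly_add, !op_poly_scal. apply field_ext; intros k; simpl; ring.
Qed.

(** A polynomial in [Lplus = L + Linv] is a Laurent polynomial in [L]. *)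
Lemma Chiu_Ladik_integrable P : integrable (Chiu_Ladik P).
Proof.
  destruct (laurent_op_poly_Lplus P (RtoC 1 :: nil) nil) as [w1 [w2 H]].
  exists w1, w2. intros p t Hp. unfold Chiu_Ladik, omega_flow.
  specialize (H (p t) Hp). unfold laurent at 2 in H. rewrite <- H.
  replace (laurent _ _ _ _ _) with (swap (p t)); [reflexivity|].
  apply field_ext; intros k; simpl; ring.
Qed.

(** * The flows *)

Lemma Lplus_fscal p c w : phase_space p -> decaying w ->
  Lplus p (fscal c w) = fscal c (Lplus p w).
Proof.
  intros Hp Hw; unfold Lplus; rewrite L_fscal, Linv_fscal by trivial.
  apply field_ext; intros k; simpl; ring.
Qed.

(** [Rop] is [Lplus + Lminus] conjugated by [rot], and [J nabla H_0] is
    [rot (i X)]; on isotropic vectors [Lplus + Lminus] is [2 Lplus]. *)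
Lemma R_flow_velocity n p : phase_space p ->
  Nat.iter n (Rop p) (J (nabla (H0 p) p))
  = rot (fscal (Ci * 2 ^ n) (Nat.iter n (Lplus p) (swap p))).
Proof.
  intros Hp.
  assert (Hi : forall n, isotropic p (Nat.iter n (Lplus p) (swap p))).
  { clear n; induction n; simpl; auto using isotropic_potential, isotropic_Lplus. }
  induction n as [|n IH].
  - cbn [Nat.iter nat_rect]. rewrite nabla_H0 by trivial.
    apply field_ext; intros k; simpl; ring.
  - rewrite !Nat.iter_succ, IH. set (w := fscal _ _).
    assert (Hw : isotropic p w) by (apply isotropic_fscal; auto).
    unfold Rop.
    replace (rot_inv (rot w)) with w by (apply field_ext; intros k; simpl; ring).
    rewrite Lminus_isotropic by trivial. unfold w.
    rewrite Lplus_fscal; trivial; [|apply Hi].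
    apply field_ext; intros k; simpl; ring.
Qed.

Lemma Copp_involutive c : - - c = c.
Proof. ring. Qed.

Lemma has_velocity_rot_inv p t w :
  has_velocity (fun s => rot_inv (p s)) t w <-> has_velocity p t (rot w).
Proof.
  split; intros H k; destruct (H k) as [H1 H2]; split; trivial.
  - apply is_derive_opp in H1; revert H1; apply is_derive_ext; intros s.
    apply (Copp_involutive (snd (p s k))).
  - apply is_derive_opp in H2; revert H2.
    change (opp (snd (rot w k))) with (- - fst (w k)).
    now rewrite Copp_involutive.
Qed.

Theorem corollary4 : forall n : nat,
  (exists P : list C, equivalent (R_flow n) (Chiu_Ladik P)) /\
  integrable (R_flow n).
Proof.
  intros n. set (P := repeat (RtoC 0) n ++ Ci * 2 ^ n :: nil).
  assert (E : equivalent (R_flow n) (Chiu_Ladik P)).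
  { intros p t Hp. unfold R_flow, Chiu_Ladik, P.
    rewrite op_poly_monomial, R_flow_velocity, has_velocity_rot_inv by trivial.
    reflexivity. }
  split; [now exists P|].
  destruct (Chiu_Ladik_integrable P) as [w1 [w2 H]].
  exists w1, w2. intros p t Hp. rewrite (E p t Hp). now apply H.
Qed.
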